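(* Let $\ell_1,\ell_2\in\mathbb{Z}$ satisfy $\ell_1+\ell_2\leq n_1-n_2+1-\delta_{n_1,n_2}$. Then $\mathcal{H}_{\langle\ell_1,\ell_2\rangle}$, whenever it is nonzero, is an irreducible highest-weight $sl(n,\mathbb{F})$-module, and $$\mathcal{B}_{\langle\ell_1,\ell_2\rangle}=\bigoplus_{m=0}^\infty\eta^m(\mathcal{H}_{\langle\ell_1-m,\ell_2-m\rangle})$$ is a decomposition into irreducible submodules (the nonzero summands being irreducible). In particular, $\mathcal{B}_{\langle\ell_1,\ell_2\rangle}=\mathcal{H}_{\langle\ell_1,\ell_2\rangle}\oplus\eta(\mathcal{B}_{\langle\ell_1-1,\ell_2-1\rangle})$.
   Context: $\mathbb{F}$ is a field of characteristic $0$, $n\geq 2$ is an integer, and $n_1,n_2$ are fixed integers with $1\leq n_1\leq n_2\leq n$. $\mathbb{N}$ is the set of nonnegative integers, $\overline{i,j}=\{i,i+1,\dots,j\}$, $\delta$ is the Kronecker delta, and $E_{i,j}$ are matrix units. Let $\mathcal{B}=\mathbb{F}[x_1,\dots,x_n,y_1,\dots,y_n]$, and write $x^\alpha y^\beta=\prod_i x_i^{\alpha_i}y_i^{\beta_i}$ for $\alpha,\beta\in\mathbb{N}^n$. Action of $sl(n,\mathbb{F})$ on $\mathcal{B}$: $E_{i,j}|_{\mathcal{B}}=E^x_{i,j}-E^y_{j,i}$ for $i,j\in\overline{1,n}$ (this defines a representation of $gl(n,\mathbb{F})$, restricted to $sl(n,\mathbb{F})$), where - $E^x_{i,j}=-x_j\partial_{x_i}-\delta_{i,j}$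 if $i,j\in\overline{1,n_1}$; $\ \partial_{x_i}\partial_{x_j}$ if $i\in\overline{1,n_1},\,j\in\overline{n_1+1,n}$; $\ -x_ix_j$ if $i\in\overline{n_1+1,n},\,j\in\overline{1,n_1}$; $\ x_i\partial_{x_j}$ if $i,j\in\overline{n_1+1,n}$; - $E^y_{i,j}=y_i\partial_{y_j}$ if $i,j\in\overline{1,n_2}$; $\ -y_iy_j$ if $i\in\overline{1,n_2},\,j\in\overline{n_2+1,n}$; $\ \partial_{y_i}\partial_{y_j}$ if $i\in\overline{n_2+1,n},\,j\in\overline{1,n_2}$; $\ -y_j\partial_{y_i}-\delta_{i,j}$ if $i,j\in\overline{n_2+1,n}$. Operators on $\mathcal{B}$: $$\mathcal{D}=-\sum_{i=1}^{n_1}x_i\partial_{y_i}+\sum_{r=n_1+1}^{n_2}\partial_{x_r}\partial_{y_r}-\sum_{s=n_2+1}^n y_s\partial_{x_s},\qquad \eta=\sum_{i=1}^{n_1}y_i\partial_{x_i}+\sum_{r=n_1+1}^{n_2}x_ry_r+\sum_{s=n_2+1}^n x_s\partial_{y_s}.$$ For $\ell_1,\ell_2\in\mathbb{Z}$, $\mathcal{B}_{\langle\ell_1,\ell_2\rangle}$ is the span of the monomials $x^\alpha y^\beta$ with $\sum_{r=n_1+1}^n\alpha_r-\sum_{i=1}^{n_1}\alpha_i=\ell_1$ and $\sum_{i=1}^{n_2}\beta_i-\sum_{r=n_2+1}^n\beta_r=\ell_2$, and $\mathcal{H}_{\langle\ell_1,\ell_2\rangle}=\{f\in\mathcal{B}_{\langle\ell_1,\ell_2\rangle}\mid\mathcal{D}(f)=0\}$.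 These are $sl(n,\mathbb{F})$-submodules, since $\mathcal{D}$ and $\eta$ commute with the action. Highest-weight is meant with respect to the diagonal Cartan subalgebra and the positive root vectors $E_{i,j}$, $i<j$. *)

(* Defs.v *)
From HB Require Import structures.
From mathcomp Require Import all_boot all_order all_algebra.
From mathcomp Require Import mpoly.
Set Implicit Arguments.
Unset Strict Implicit.
Unset Printing Implicit Defensive.
Import GRing.Theory.
Local Open Scope ring_scope.

(* Subspaces of the (infinite-dimensional) space are Prop-valued predicates,
   so that irreducibility quantifies over all submodules, not only over the
   decidable ones. *)

Definition subspace (F : fieldType) (V : lmodType F) (U : V -> Prop) : Prop :=
  U 0 /\ forall (a : F) (u v : V), U u -> U v -> U (a *: u + v).

Definition lin_span (F : fieldType) (V : lmodType F) (S : V -> Prop) (v : V) : Prop :=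
  exists (k : nat) (c : 'I_k -> F) (b : 'I_k -> V),
    (forall i, S (b i)) /\ v = \sum_(i < k) c i *: b i.

Definition nonzero (F : fieldType) (V : lmodType F) (U : V -> Prop) : Prop :=
  exists2 v : V, U v & v != 0.

Definition img (F : fieldType) (V : lmodType F) (f : V -> V) (U : V -> Prop)
    (v : V) : Prop :=
  exists2 u : V, U u & v = f u.

Definition is_direct_sum (F : fieldType) (V : lmodType F) (W : V -> Prop)
    (U : nat -> V -> Prop) : Prop :=
  [/\ forall m, subspace (U m),
      forall w, W w <->
        exists (k : nat) (u : nat -> V),
          (forall m, U m (u m)) /\ w = \sum_(m < k) u m
    & forall (k : nat) (u : nat -> V), (forall m, U m (u m)) ->
        \sum_(m < k) u m = 0 -> forall m, (m < k)%N -> u m = 0].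

Definition is_direct_sum2 (F : fieldType) (V : lmodType F)
    (W U1 U2 : V -> Prop) : Prop :=
  [/\ subspace U1, subspace U2,
      forall w, W w <-> exists u1 u2 : V, [/\ U1 u1, U2 u2 & w = u1 + u2]
    & forall v, U1 v -> U2 v -> v = 0].

(* rho gives the action of n x n matrices on V; only its values on sl(n),
   the matrices of trace 0, are used below. *)

Definition sl_submodule (F : fieldType) (n : nat) (V : lmodType F)
    (rho : 'M[F]_n -> V -> V) (U : V -> Prop) : Prop :=
  subspace U /\
  forall A : 'M[F]_n, \tr A = 0 -> forall v, U v -> U (rho A v).

Definition sl_irreducible (F : fieldType) (n : nat) (V : lmodType F)
    (rho : 'M[F]_n -> V -> V) (U : V -> Prop) : Prop :=
  [/\ sl_submodule rho U, nonzero U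
    & forall W : V -> Prop, sl_submodule rho W -> (forall v, W v -> U v) ->
        (forall v, W v -> v = 0) \/ (forall v, U v -> W v)].

(* The weight is a linear functional on the traceless diagonal matrices, given
   as the restriction of a functional d |-> \sum_i lam_i d_i. *)
Definition highest_weight_vector (F : fieldType) (n : nat) (V : lmodType F)
    (rho : 'M[F]_n -> V -> V) (v : V) : Prop :=
  [/\ v != 0,
      exists lam : 'rV[F]_n, forall d : 'rV[F]_n, \tr (diag_mx d) = 0 ->
        rho (diag_mx d) v = (\sum_(i < n) lam 0 i * d 0 i) *: v
    & forall i j : 'I_n, (i < j)%N -> rho (delta_mx i j) v = 0].

Definition highest_weight_module (F : fieldType) (n : nat) (V : lmodType F)
    (rho : 'M[F]_n -> V -> V) (U : V -> Prop) : Prop :=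
  sl_submodule rho U /\
  exists v : V,
    [/\ U v, highest_weight_vector rho v
      & forall W : V -> Prop, sl_submodule rho W -> W v ->
          forall u, U u -> W u].

(* F[x_1..x_n, y_1..y_n]: the variables of index < n are the x's, the remaining
   n the y's.  Indices are shifted by one: i : 'I_n stands for i + 1, so that
   i in {1..n1} reads i < n1, and i in {n1+1..n} reads n1 <= i. *)

Definition xvar (F : fieldType) (n : nat) (i : 'I_n) : {mpoly F[n + n]} :=
  'X_(lshift n i).
Definition yvar (F : fieldType) (n : nat) (i : 'I_n) : {mpoly F[n + n]} :=
  'X_(rshift n i).
Definition dx (F : fieldType) (n : nat) (i : 'I_n) (f : {mpoly F[n + n]}) :
    {mpoly F[n + n]} := f^`M(lshift n i).
Definition dy (F : fieldType) (n : nat) (i : 'I_n) (f : {mpoly F[n + n]}) :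
    {mpoly F[n + n]} := f^`M(rshift n i).

Definition Ex (F : fieldType) (n n1 : nat) (i j : 'I_n)
    (f : {mpoly F[n + n]}) : {mpoly F[n + n]} :=
  if (i < n1)%N then
    if (j < n1)%N then - (xvar F j * dx i f) - (i == j)%:R *: f
    else dx i (dx j f)
  else
    if (j < n1)%N then - (xvar F i * xvar F j * f)
    else xvar F i * dx j f.

Definition Ey (F : fieldType) (n n2 : nat) (i j : 'I_n)
    (f : {mpoly F[n + n]}) : {mpoly F[n + n]} :=
  if (i < n2)%N then
    if (j < n2)%N then yvar F i * dy j f
    else - (yvar F i * yvar F j * f)
  else
    if (j < n2)%N then dy i (dy j f)
    else - (yvar F j * dy i f) - (i == j)%:R *: f.

Definition act (F : fieldType) (n n1 n2 : nat) (A : 'M[F]_n)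
    (f : {mpoly F[n + n]}) : {mpoly F[n + n]} :=
  \sum_(i < n) \sum_(j < n) A i j *: (Ex n1 i j f - Ey n2 j i f).

Definition Dop (F : fieldType) (n n1 n2 : nat) (f : {mpoly F[n + n]}) :
    {mpoly F[n + n]} :=
  - (\sum_(i < n | (i < n1)%N) xvar F i * dy i f)
  + \sum_(r < n | (n1 <= r < n2)%N) dx r (dy r f)
  - \sum_(s < n | (n2 <= s)%N) yvar F s * dx s f.

Definition etaop (F : fieldType) (n n1 n2 : nat) (f : {mpoly F[n + n]}) :
    {mpoly F[n + n]} :=
  \sum_(i < n | (i < n1)%N) yvar F i * dx i f
  + \sum_(r < n | (n1 <= r < n2)%N) xvar F r * yvar F r * f
  + \sum_(s < n | (n2 <= s)%N) xvar F s * dy s f.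

Definition xdeg (n n1 : nat) (m : 'X_{1..n + n}) : int :=
  \sum_(r < n | (n1 <= r)%N) (m (lshift n r))%:Z
  - \sum_(i < n | (i < n1)%N) (m (lshift n i))%:Z.
Definition ydeg (n n2 : nat) (m : 'X_{1..n + n}) : int :=
  \sum_(i < n | (i < n2)%N) (m (rshift n i))%:Z
  - \sum_(r < n | (n2 <= r)%N) (m (rshift n r))%:Z.

Definition Bgr (F : fieldType) (n n1 n2 : nat) (l1 l2 : int) :
    {mpoly F[n + n]} -> Prop :=
  lin_span (fun f => exists m : 'X_{1..n + n},
    [/\ xdeg n1 m = l1, ydeg n2 m = l2 & f = 'X_[m]]).

Definition Hgr (F : fieldType) (n n1 n2 : nat) (l1 l2 : int)
    (f : {mpoly F[n + n]}) : Prop :=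
  Bgr n1 n2 l1 l2 f /\ Dop n1 n2 f = 0.

(* Main.v *)
Require Import Defs.
From HB Require Import structures.
From mathcomp Require Import all_boot all_order all_algebra.
From mathcomp Require Import mpoly.
From mathcomp Require Import zify ring.
From Stdlib Require Import Classical.
Set Implicit Arguments.
Unset Strict Implicit.
Unset Printing Implicit Defensive.
Import Order.TTheory GRing.Theory Num.Theory.
Local Open Scope ring_scope.

(** Write P_i, Q_i for the operators that the partial Fourier transform in
    x_1, .., x_{n1} makes of multiplication by x_i and of the derivation in
    x_i, and P'_i, Q'_i for their analogues with y_i, transformed for the
    indices above n2.  Then E_ij = P_i Q_j - P'_j Q'_i, D = sum_i Q_i Q'_i and
    eta = sum_i P_i P'_i, and the Weyl relations alone show that D and eta
    commute with gl(n) and that [D, eta] acts on the (l1, l2)-component of B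
    as the integer c = l1 + l2 + n2 - n1.

    Decomposition.  On a kernel vector of D lying j levels below (l1, l2), the
    operator D^k eta^k with k <= j is a product of the numbers
    i (c - 2 j + i - 1), 1 <= i <= k, none of which vanishes since c <= 1.  As
    D is locally nilpotent, this gives the direct sum by the usual sl(2)
    argument ([decompose], [independent]).

    Irreducibility of H = ker D rests on three facts.

    - Every nonzero submodule contains a singular vector, one killed by all
      E_ij with i < j: these operators increase a statistic of the weight
      that is bounded in terms of the total degree, and they do not increase
      that degree ([singular_exists]).

    - The singular vectors of H form at most a line ([singular_unique]).  Read
      off on coefficients, the equations E_ij f = 0 and D f = 0 become
      recurrences.  They show first that a nonzero solution involves a
      monomial free of y_{n1} and of x_{n2+1} ([lowest_vanish]), then that
      this monomial is determined by l1 and l2 ([lowest_unique]).  The bound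
      on l1 + l2 enters in the second step: the recurrences yield an equation
      A chi = 0 with A an integer that the bound makes nonzero
      ([sing_mid_x0]).  A combination of two singular vectors in which the
      monomial cancels is therefore zero.

    - There is a bilinear form with orthogonal monomials for which E_ij is the
      transpose of E_ji and D that of eta ([cform_Eop], [cform_Dop]).  Since
      B = H + eta B, it is nondegenerate on H.

    Let v be a singular vector of H.  A vector of H of the same weight as v is
    singular, otherwise a raising operator would lead to a singular vector of
    larger weight; so it is a multiple of v, and nondegeneracy forces
    (v, v) <> 0 ([hw_not_isotropic]).  If v generated a proper submodule W,
    then, weight spaces being finite-dimensional, some nonzero h in H would be
    orthogonal to W; the orthogonal of W in H, a nonzero submodule, would
    contain v, and (v, v) would be 0 ([hw_generates]).  So v generates H, and
    every nonzero submodule of H, containing v, is H.  The powers of eta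
    commute with the action and transport irreducibility to the other
    summands. *)

Local Notation x_ i := (lshift _ i).
Local Notation y_ i := (rshift _ i).

(** [lia] takes the bound of an ordinal only from a hypothesis. *)
Ltac ord_bound i :=
  lazymatch goal with
  | _ : is_true (nat_of_ord i < _)%N |- _ => fail
  | _ => pose proof (ltn_ord i)
  end.
Ltac ord_bounds := repeat match goal with
  | i : 'I__ |- _ => ord_bound i
  | i : Finite.sort _ |- _ => ord_bound i
  end.
Ltac coord :=
  rewrite ?(mnmDE, mnmBE, mnm1E, eq_lrshift, eq_rlshift, eq_lshift, eq_rshift)
    -?val_eqE /=; ord_bounds.
(** Equations between monomials are checked exponent by exponent.  The
    truncated subtractions are exact because of hypotheses on the exponents
    of [m]. *)
Ltac mnm_eq m := ord_bounds; let u := fresh "u" in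
  apply/mnmP=> u; rewrite !(mnmDE, mnmBE, mnm1E);
  repeat (case: eqP=> [/[dup] /(congr1 (fun v => m v)) /= ? /(congr1 val) /= ?|_]);
  lia.

(** * Twisted oscillators *)

Section Operators.
Variables (F : fieldType) (n n1 n2 : nat).
Local Notation V := {mpoly F[n + n]}.
Implicit Types (f g : V) (i j : 'I_n).

(** The transform replaces the pair (x_i, d/dx_i) by (d/dx_i, - x_i), which
    satisfies the same commutation relation. *)
Definition Px i f : V := if (i < n1)%N then dx i f else xvar F i * f.
Definition Qx i f : V := if (i < n1)%N then - (xvar F i * f) else dx i f.
Definition Py i f : V := if (i < n2)%N then yvar F i * f else dy i f.
Definition Qy i f : V := if (i < n2)%N then dy i f else - (yvar F i * f).
Definition Eop i j f : V := Ex n1 i j f - Ey n2 j i f.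

Lemma Px_linear i : linear (Px i).
Proof.
move=> a f g; rewrite /Px; case: ifP => _; first by rewrite /dx linearP.
by rewrite mulrDr -scalerAr.
Qed.
Lemma Qx_linear i : linear (Qx i).
Proof.
move=> a f g; rewrite /Qx; case: ifP => _; last by rewrite /dx linearP.
by rewrite mulrDr -scalerAr opprD scalerN.
Qed.
Lemma Py_linear i : linear (Py i).
Proof.
move=> a f g; rewrite /Py; case: ifP => _; last by rewrite /dy linearP.
by rewrite mulrDr -scalerAr.
Qed.
Lemma Qy_linear i : linear (Qy i).
Proof.
move=> a f g; rewrite /Qy; case: ifP => _; first by rewrite /dy linearP.
by rewrite mulrDr -scalerAr opprD scalerN.
Qed.
HB.instance Definition _ i := GRing.isLinear.Build F V V _ (Px i) (Px_linear i).
HB.instance Definition _ i := GRing.isLinear.Build F V V _ (Qx i) (Qx_linear i).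
HB.instance Definition _ i := GRing.isLinear.Build F V V _ (Py i) (Py_linear i).
HB.instance Definition _ i := GRing.isLinear.Build F V V _ (Qy i) (Qy_linear i).

Lemma der_mulX (u v : 'I_(n + n)) f :
  ('X_v * f)^`M(u) = 'X_v * f^`M(u) + (u == v)%:R *: f.
Proof.
rewrite mderivM mderivX mnm1E eq_sym addrC; congr (_ + _).
case: eqP => [->|_]; last by rewrite !scale0r mul0r.
by rewrite -{1}[U_(v)%MM]add0m addmK mpolyX0 !scale1r mul1r.
Qed.

Lemma Qx_Px i j f : Qx i (Px j f) = Px j (Qx i f) + (i == j)%:R *: f.
Proof.
rewrite /Qx /Px /dx /xvar; case: (ltnP i n1) => ii; case: (ltnP j n1) => jj.
- by rewrite mderivN der_mulX eq_lshift eq_sym opprD addrNK.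
- have -> : (i == j) = false by rewrite -val_eqE /=; lia.
  by rewrite scale0r addr0 mulrN mulrCA.
- have -> : (i == j) = false by rewrite -val_eqE /=; lia.
  by rewrite scale0r addr0 mderiv_comm.
- by rewrite der_mulX eq_lshift.
Qed.

Lemma Qy_Py i j f : Qy i (Py j f) = Py j (Qy i f) + (i == j)%:R *: f.
Proof.
rewrite /Qy /Py /dy /yvar; case: (ltnP i n2) => ii; case: (ltnP j n2) => jj.
- by rewrite der_mulX eq_rshift.
- have -> : (i == j) = false by rewrite -val_eqE /=; lia.
  by rewrite scale0r addr0 mderiv_comm.
- have -> : (i == j) = false by rewrite -val_eqE /=; lia.
  by rewrite scale0r addr0 mulrN mulrCA.
- by rewrite mderivN der_mulX eq_rshift eq_sym opprD addrNK.
Qed.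

Lemma Px_Px i j f : Px i (Px j f) = Px j (Px i f).
Proof.
rewrite /Px /dx /xvar; case: (ltnP i n1) => ii; case: (ltnP j n1) => jj.
- by rewrite mderiv_comm.
- rewrite der_mulX eq_lshift (_ : (i == j) = false) ?scale0r ?addr0 //.
  by rewrite -val_eqE /=; lia.
- rewrite der_mulX eq_lshift (_ : (j == i) = false) ?scale0r ?addr0 //.
  by rewrite -val_eqE /=; lia.
- by rewrite mulrCA.
Qed.

Lemma Qx_Qx i j f : Qx i (Qx j f) = Qx j (Qx i f).
Proof.
rewrite /Qx /dx /xvar; case: (ltnP i n1) => ii; case: (ltnP j n1) => jj.
- by rewrite !mulrN !opprK mulrCA.
- rewrite mderivN der_mulX eq_lshift (_ : (j == i) = false) ?scale0r ?addr0 //.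
  by rewrite -val_eqE /=; lia.
- rewrite mderivN der_mulX eq_lshift (_ : (i == j) = false) ?scale0r ?addr0 //.
  by rewrite -val_eqE /=; lia.
- by rewrite mderiv_comm.
Qed.

Lemma Py_Py i j f : Py i (Py j f) = Py j (Py i f).
Proof.
rewrite /Py /dy /yvar; case: (ltnP i n2) => ii; case: (ltnP j n2) => jj.
- by rewrite mulrCA.
- rewrite der_mulX eq_rshift (_ : (j == i) = false) ?scale0r ?addr0 //.
  by rewrite -val_eqE /=; lia.
- rewrite der_mulX eq_rshift (_ : (i == j) = false) ?scale0r ?addr0 //.
  by rewrite -val_eqE /=; lia.
- by rewrite mderiv_comm.
Qed.

Lemma Qy_Qy i j f : Qy i (Qy j f) = Qy j (Qy i f).
Proof.
rewrite /Qy /dy /yvar; case: (ltnP i n2) => ii; case: (ltnP j n2) => jj.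
- by rewrite mderiv_comm.
- rewrite mderivN der_mulX eq_rshift (_ : (i == j) = false) ?scale0r ?addr0 //.
  by rewrite -val_eqE /=; lia.
- rewrite mderivN der_mulX eq_rshift (_ : (j == i) = false) ?scale0r ?addr0 //.
  by rewrite -val_eqE /=; lia.
- by rewrite !mulrN !opprK mulrCA.
Qed.

Let xy := (der_mulX, eq_lrshift, eq_rlshift, scale0r, addr0, mderivN, mulrN).

Lemma Px_Py i j f : Px i (Py j f) = Py j (Px i f).
Proof.
rewrite /Px /Py /dx /dy /xvar /yvar; case: ifP => _; case: ifP => _;
  by rewrite ?xy //; (rewrite mulrCA || rewrite mderiv_comm).
Qed.
Lemma Px_Qy i j f : Px i (Qy j f) = Qy j (Px i f).
Proof.
rewrite /Px /Qy /dx /dy /xvar /yvar; case: ifP => _; case: ifP => _;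
  by rewrite ?xy //; (rewrite mulrCA || rewrite mderiv_comm).
Qed.
Lemma Qx_Py i j f : Qx i (Py j f) = Py j (Qx i f).
Proof.
rewrite /Qx /Py /dx /dy /xvar /yvar; case: ifP => _; case: ifP => _;
  by rewrite ?xy //; (rewrite mulrCA || rewrite mderiv_comm).
Qed.
Lemma Qx_Qy i j f : Qx i (Qy j f) = Qy j (Qx i f).
Proof.
rewrite /Qx /Qy /dx /dy /xvar /yvar; case: ifP => _; case: ifP => _;
  by rewrite ?xy //; (rewrite mulrCA || rewrite mderiv_comm).
Qed.

Lemma ExE i j f : Ex n1 i j f = Px i (Qx j f).
Proof.
rewrite /Ex /Px /Qx; case: ifP => _; case: ifP => _ //.
- by rewrite /dx mderivN /xvar der_mulX eq_lshift opprD.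
- by rewrite mulrN mulrA.
Qed.

Lemma EyE i j f : Ey n2 i j f = Py i (Qy j f).
Proof.
rewrite /Ey /Py /Qy; case: ifP => _; case: ifP => _ //.
- by rewrite mulrN mulrA.
- by rewrite /dy mderivN /yvar der_mulX eq_rshift opprD.
Qed.

Lemma EopE i j f : Eop i j f = Px i (Qx j f) - Py j (Qy i f).
Proof. by rewrite /Eop ExE EyE. Qed.

Lemma Eop_linear i j : linear (Eop i j).
Proof.
move=> a f g; rewrite !EopE (Qx_linear j) (Px_linear i) (Qy_linear i) (Py_linear j).
by rewrite opprD addrACA scalerBr.
Qed.
HB.instance Definition _ i j := GRing.isLinear.Build F V V _ (Eop i j) (Eop_linear i j).

Lemma actE (A : 'M[F]_n) f : act n1 n2 A f = \sum_i \sum_j A i j *: Eop i j f.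
Proof. by []. Qed.

Lemma DopE f : (n1 <= n2)%N -> Dop n1 n2 f = \sum_i Qx i (Qy i f).
Proof.
move=> n12; rewrite /Dop [RHS](bigID (fun i : 'I_n => (i < n1)%N)) /=.
rewrite [X in _ = _ + X](bigID (fun i : 'I_n => (i < n2)%N)) /= addrA.
rewrite -!sumrN; congr (_ + _ + _); apply: congr_big => // i.
- by move=> iP; rewrite /Qx /Qy iP (leq_trans iP n12).
- by lia.
- by move=> iP; rewrite /Qx /Qy; have -> : (i < n1)%N = false by [lia]; have -> : (i < n2)%N by lia.
- by lia.
- move=> iP; rewrite /Qx /Qy; have -> : (i < n1)%N = false by lia.
  have -> : (i < n2)%N = false by lia.
  by rewrite /dx /yvar mderivN der_mulX eq_lrshift scale0r addr0.
Qed.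

Lemma etaopE f : (n1 <= n2)%N -> etaop n1 n2 f = \sum_i Px i (Py i f).
Proof.
move=> n12; rewrite /etaop [RHS](bigID (fun i : 'I_n => (i < n1)%N)) /=.
rewrite [X in _ = _ + X](bigID (fun i : 'I_n => (i < n2)%N)) /= addrA.
congr (_ + _ + _); apply: congr_big => // i.
- move=> iP; rewrite /Px /Py iP (leq_trans iP n12).
  by rewrite /dx /yvar der_mulX eq_lrshift scale0r addr0.
- by lia.
- move=> iP; rewrite /Px /Py; have -> : (i < n1)%N = false by [lia].
  by have -> : (i < n2)%N by [lia]; rewrite mulrA.
- by lia.
- move=> iP; rewrite /Px /Py; have -> : (i < n1)%N = false by lia.
  by have -> : (i < n2)%N = false by lia.
Qed.

Lemma sum_delta (G : 'I_n -> V) i : \sum_k (k == i)%:R *: G k = G i.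
Proof.
rewrite (bigD1 i) //= eqxx scale1r big1 ?addr0 // => k /negbTE->.
by rewrite scale0r.
Qed.

(** In the sum defining D only the index i fails to commute with the first term
    of E_ij, and only the index j with the second; both defects are Q_j Q'_i. *)
Lemma Dop_Eop i j f : (n1 <= n2)%N -> Dop n1 n2 (Eop i j f) = Eop i j (Dop n1 n2 f).
Proof.
move=> n12; rewrite !DopE // linear_sum /=.
rewrite (eq_bigr (fun k => Eop i j (Qx k (Qy k f))
   + ((k == i)%:R *: Qx j (Qy k f) - (k == j)%:R *: Qx k (Qy i f)))); last first.
  move=> k _; rewrite !EopE !linearB /=.
  rewrite -(Px_Qy i k) -(Qx_Qy j k) Qx_Px (Qx_Qx k j).
  rewrite Qy_Py (Qy_Qy k i) linearD linearZ /= (Qx_Py k j) (Qx_Qy k i).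
  by rewrite opprD addrACA.
by rewrite big_split /= -[RHS]addr0; congr (_ + _); rewrite sumrB !sum_delta subrr.
Qed.

(** Here the two defects are P_i P'_j. *)
Lemma etaop_Eop i j f : (n1 <= n2)%N ->
  etaop n1 n2 (Eop i j f) = Eop i j (etaop n1 n2 f).
Proof.
move=> n12; rewrite !etaopE // linear_sum /=.
rewrite [RHS](eq_bigr (fun k => Px k (Py k (Eop i j f))
   + ((k == j)%:R *: Px i (Py k f) - (k == i)%:R *: Py j (Px k f)))); last first.
  move=> k _; rewrite !EopE !linearB /=.
  have -> : Px i (Qx j (Px k (Py k f)))
      = Px k (Py k (Px i (Qx j f))) + (k == j)%:R *: Px i (Py k f).
    by rewrite Qx_Px linearD linearZ /= Qx_Py Px_Px (Px_Py i k) (eq_sym j).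
  have -> : Py j (Qy i (Px k (Py k f)))
      = Px k (Py k (Py j (Qy i f))) + (k == i)%:R *: Py j (Px k f).
    by rewrite -Px_Qy -!Px_Py Qy_Py !linearD !linearZ /= Py_Py (eq_sym i).
  by rewrite opprD addrACA.
rewrite big_split /= -[LHS]addr0; congr (_ + _).
by rewrite sumrB !sum_delta Px_Py subrr.
Qed.

(** The summands of D and eta with different indices commute; those of equal
    index k contribute [Q_k Q'_k, P_k P'_k] = P_k Q_k + P'_k Q'_k + 1. *)
Lemma Dop_etaop f : (n1 <= n2)%N ->
  Dop n1 n2 (etaop n1 n2 f) = etaop n1 n2 (Dop n1 n2 f)
    + \sum_k (Px k (Qx k f) + Py k (Qy k f) + f).
Proof.
move=> n12; rewrite !DopE // !etaopE //.
rewrite (eq_bigr (fun k => \sum_l Px l (Py l (Qx k (Qy k f)))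
  + (Px k (Qx k f) + Py k (Qy k f) + f))); last first.
  move=> k _; rewrite !linear_sum /=.
  rewrite (eq_bigr (fun l => Px l (Py l (Qx k (Qy k f)))
    + (l == k)%:R *: (Px l (Qx k f) + Py l (Qy k f) + f))); last first.
    move=> l _; rewrite -Px_Qy Qx_Px Qy_Py (eq_sym k).
    case: eqP => [->|_]; rewrite ?scale0r ?scale1r ?addr0 ?Qx_Py //.
    by rewrite !linearD /= Qx_Py -!addrA.
  by rewrite big_split /= sum_delta.
rewrite big_split /= exchange_big /=; congr (_ + _).
by apply: eq_bigr => l _; rewrite !linear_sum.
Qed.
End Operators.

Section Linear.
Variables (F : fieldType) (n n1 n2 : nat).
Local Notation V := {mpoly F[n + n]}.

Let sum_mul_linear (u : 'I_n -> V) (d : 'I_n -> V -> V) (P : pred 'I_n) a f g :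
  (forall i, linear (d i)) ->
  \sum_(i < n | P i) u i * d i (a *: f + g)
  = a *: (\sum_(i < n | P i) u i * d i f) + \sum_(i < n | P i) u i * d i g.
Proof.
move=> dl; rewrite scaler_sumr -big_split; apply: eq_bigr => i _ /=.
by rewrite dl mulrDr -scalerAr.
Qed.

Lemma Dop_linear : linear (@Dop F n n1 n2).
Proof.
move=> a f g; rewrite /Dop !sum_mul_linear; try by move=> i ? ? ?; rewrite /dx /dy linearP.
have -> : \sum_(r < n | (n1 <= r < n2)%N) dx r (dy r (a *: f + g))
  = a *: (\sum_(r < n | (n1 <= r < n2)%N) dx r (dy r f))
    + \sum_(r < n | (n1 <= r < n2)%N) dx r (dy r g).
  rewrite scaler_sumr -big_split; apply: eq_bigr => i _ /=.
  by rewrite /dx /dy !linearP.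
by rewrite !opprD [X in X + _ = _]addrACA [LHS]addrACA -!scalerN -!scalerDr.
Qed.

Lemma etaop_linear : linear (@etaop F n n1 n2).
Proof.
move=> a f g; rewrite /etaop !sum_mul_linear; try by move=> i ? ? ?; rewrite /dx /dy linearP.
have -> : \sum_(r < n | (n1 <= r < n2)%N) xvar F r * yvar F r * (a *: f + g)
  = a *: (\sum_(r < n | (n1 <= r < n2)%N) xvar F r * yvar F r * f)
    + \sum_(r < n | (n1 <= r < n2)%N) xvar F r * yvar F r * g.
  rewrite scaler_sumr -big_split; apply: eq_bigr => i _ /=.
  by rewrite mulrDr -scalerAr.
by rewrite [X in X + _ = _]addrACA [LHS]addrACA -!scalerDr.
Qed.

HB.instance Definition _ := GRing.isLinear.Build F V V _ (@Dop F n n1 n2) Dop_linear.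
HB.instance Definition _ := GRing.isLinear.Build F V V _ (@etaop F n n1 n2) etaop_linear.

Lemma act_linear (A : 'M[F]_n) : linear (@act F n n1 n2 A).
Proof.
move=> a f g; rewrite !actE scaler_sumr -big_split; apply: eq_bigr => i _ /=.
rewrite scaler_sumr -big_split; apply: eq_bigr => j _ /=.
by rewrite linearP scalerDr !scalerA mulrC.
Qed.
HB.instance Definition _ A := GRing.isLinear.Build F V V _ (@act F n n1 n2 A) (act_linear A).

Lemma act_delta i j f : @act F n n1 n2 (delta_mx i j) f = Eop n1 n2 i j f.
Proof.
rewrite actE (bigD1 i) //= (bigD1 j) //= mxE !eqxx scale1r.
rewrite !big1 ?addr0 // => [k /negbTE ki|k /negbTE kj].
  by rewrite big1 // => l _; rewrite mxE ki scale0r.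
by rewrite mxE kj andbF scale0r.
Qed.

Lemma act_diag (d : 'rV[F]_n) f :
  @act F n n1 n2 (diag_mx d) f = \sum_i d 0 i *: Eop n1 n2 i i f.
Proof.
rewrite actE; apply: eq_bigr => i _; rewrite (bigD1 i) //= mxE eqxx mulr1n.
by rewrite big1 ?addr0 // => j /negbTE ji; rewrite mxE eq_sym ji mulr0n scale0r.
Qed.

(** E_ii is not in sl(n), but differs from this traceless operator by a multiple
    of the identity matrix, which acts on each component of B by a scalar. *)
Lemma act_trace0 i f (a : F) :
  @act F n n1 n2 (delta_mx i i - a%:M) f
  = Eop n1 n2 i i f - a *: \sum_k Eop n1 n2 k k f.
Proof.
have -> : delta_mx i i - a%:M = diag_mx (\row_k ((k == i)%:R - a)).
  apply/matrixP => k l; rewrite !mxE; case: (eqVneq k l) => [->|kl].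
    by rewrite andbb !mulr1n.
  rewrite !mulr0n subr0; case: eqP => //= ki; case: eqP => //= li.
  by move: kl; rewrite ki li eqxx.
rewrite act_diag (eq_bigr (fun k => (k == i)%:R *: Eop n1 n2 k k f - a *: Eop n1 n2 k k f)).
  by rewrite sumrB sum_delta scaler_sumr.
by move=> k _; rewrite mxE scalerBl.
Qed.

(** The relations of the matrix units.  They are what makes the space of
    singular vectors stable under the E_ii. *)
Lemma Eop_bracket i j k l (f : V) :
  Eop n1 n2 i j (Eop n1 n2 k l f) = Eop n1 n2 k l (Eop n1 n2 i j f)
    + ((j == k)%:R *: Eop n1 n2 i l f - (l == i)%:R *: Eop n1 n2 k j f).
Proof.
have X a b c d g : Px n1 a (Qx n1 b (Px n1 c (Qx n1 d g)))
    = Px n1 a (Px n1 c (Qx n1 b (Qx n1 d g))) + (b == c)%:R *: Px n1 a (Qx n1 d g) :> V.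
  by rewrite Qx_Px linearD linearZ.
have Y a b c d g : Py n2 a (Qy n2 b (Py n2 c (Qy n2 d g)))
    = Py n2 a (Py n2 c (Qy n2 b (Qy n2 d g))) + (b == c)%:R *: Py n2 a (Qy n2 d g) :> V.
  by rewrite Qy_Py linearD linearZ.
have XY a b c d g : Px n1 a (Qx n1 b (Py n2 c (Qy n2 d g)))
    = Py n2 c (Qy n2 d (Px n1 a (Qx n1 b g))) :> V.
  by rewrite Qx_Py Qx_Qy Px_Py Px_Qy.
rewrite !EopE !linearB /= !XY !X !Y (eq_sym i l) (eq_sym k j).
rewrite (Px_Px _ k i) (Qx_Qx _ l j) (Py_Py _ l j) (Qy_Qy _ k i).
case: (j == k); case: (l == i); rewrite ?scale1r ?scale0r ?addr0 ?subr0 ?sub0r ?opprD ?opprK;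
  set A := Px n1 i (Px n1 k _); set B := Py n2 j (Py n2 l _);
  set C := Py n2 l _; set E := Py n2 j _; ring.
Qed.
End Linear.

(** * Gradings *)

Section Coefficients.
Variables (F : fieldType) (k : nat).
Implicit Types (f g : {mpoly F[k]}) (m : 'X_{1..k}).

Lemma coef_mulX (u : 'I_k) f m :
  ('X_u * f)@_m = if (0 < m u)%N then f@_(m - U_(u)) else 0.
Proof.
rewrite mulrC; case: posnP => [mu0|mu].
  apply/eqP; rewrite mcoeff_eq0 (perm_mem (msuppMX _ _)).
  apply/mapP => -[p _ mE]; move: mu0; rewrite mE mnmDE mnm1E eqxx; lia.
have {1}-> : m = (U_(u) + (m - U_(u)))%MM.
  by apply/mnmP=> v; rewrite !(mnmDE, mnmBE, mnm1E); case: eqP => [<-|_]; lia.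
by rewrite mcoeffMX.
Qed.

(** All degrees and weights in use are, up to constants, linear functions of the
    exponents. *)
Definition mgrade (c : 'I_k -> int) m : int := \sum_u c u * (m u)%:Z.

Lemma mgrade_addU c m u : mgrade c (m + U_(u))%MM = mgrade c m + c u.
Proof.
rewrite /mgrade (eq_bigr (fun v => c v * (m v)%:Z + c v * (u == v)%:Z)); last first.
  by move=> v _; rewrite mnmDE mnm1E PoszD mulrDr.
rewrite big_split /=; congr (_ + _); rewrite (bigD1 u) //= eqxx mulr1.
by rewrite big1 ?addr0 // => v /negbTE; rewrite eq_sym => ->; rewrite mulr0.
Qed.

(** The predicate [Q] is arbitrary so that the same shift lemmas serve for
    homogeneity ([eq^~ 0]) and for bounds ([<= 0] or [0 <=]). *)
Definition graded (Q : int -> Prop) (c : 'I_k -> int) (t : int) f : Prop :=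
  forall m, f@_m != 0 -> Q (mgrade c m - t).

Lemma graded_mulX Q c t u f : graded Q c t f -> graded Q c (t + c u) ('X_u * f).
Proof.
move=> gf m; rewrite coef_mulX; case: ifP => [mu /gf|_]; last by rewrite eqxx.
have {2}-> : m = (m - U_(u) + U_(u))%MM.
  by apply/mnmP=> v; rewrite !(mnmDE, mnmBE, mnm1E); case: eqP => [<-|_]; lia.
by rewrite mgrade_addU opprD addrACA subrr addr0.
Qed.

Lemma graded_der Q c t u f : graded Q c t f -> graded Q c (t - c u) f^`M(u).
Proof.
move=> gf m; rewrite mcoeff_deriv => fm.
have /gf : f@_(m + U_(u)) != 0 by apply: contraNneq fm => ->; rewrite mul0rn.
by rewrite mgrade_addU; congr Q; ring.
Qed.

Lemma graded0 Q c t : graded Q c t 0.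
Proof. by move=> m; rewrite mcoeff0 eqxx. Qed.

Lemma gradedD Q c t f g : graded Q c t f -> graded Q c t g -> graded Q c t (f + g).
Proof.
move=> gf gg m; rewrite mcoeffD; have [f0|/gf//] := eqVneq f@_m 0.
by rewrite f0 add0r => /gg.
Qed.

Lemma gradedZ Q c t a f : graded Q c t f -> graded Q c t (a *: f).
Proof. by move=> gf m; rewrite mcoeffZ mulf_eq0 negb_or => /andP[_ /gf]. Qed.

Lemma gradedN Q c t f : graded Q c t f -> graded Q c t (- f).
Proof. by move=> gf; rewrite -scaleN1r; apply: gradedZ. Qed.

Lemma graded_sum Q c t (I : Type) (r : seq I) (P : pred I) (f : I -> {mpoly F[k]}) :
  (forall i, P i -> graded Q c t (f i)) -> graded Q c t (\sum_(i <- r | P i) f i).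
Proof.
move=> gf; elim/big_rec: _ => [|i g Pi gg]; first exact: graded0.
by apply: gradedD => //; apply: gf.
Qed.

End Coefficients.

Section Grading.
Variables (F : fieldType) (n n1 n2 : nat).
Local Notation V := {mpoly F[n + n]}.
Implicit Types (f g : V) (m : 'X_{1..n + n}) (i j : 'I_n).

(** The transformed variables are those of index less than [n1] among the x's
    and of index at least [n2] among the y's.  Multiplication by a variable and
    its transform change a degree in opposite directions. *)
Definition sgn_lt (p : nat) i : int := if (i < p)%N then -1 else 1.
Local Notation sgx := (sgn_lt n1).
Local Notation sgy := (sgn_lt n2).

Lemma graded_Px Q c t i f : graded Q c t f ->
  graded Q c (t + sgx i * c (x_ i)) (Px n1 i f).
Proof.
rewrite /sgn_lt /Px; case: ifP => _ gf; last by rewrite mul1r; apply: graded_mulX.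
by rewrite mulN1r; apply: graded_der.
Qed.

Lemma graded_Qx Q c t i f : graded Q c t f ->
  graded Q c (t - sgx i * c (x_ i)) (Qx n1 i f).
Proof.
rewrite /sgn_lt /Qx; case: ifP => _ gf; last by rewrite mul1r; apply: graded_der.
by rewrite mulN1r opprK; apply: gradedN; apply: graded_mulX.
Qed.

Lemma graded_Py Q c t i f : graded Q c t f ->
  graded Q c (t - sgy i * c (y_ i)) (Py n2 i f).
Proof.
rewrite /sgn_lt /Py; case: ifP => _ gf; last by rewrite mul1r; apply: graded_der.
by rewrite mulN1r opprK; apply: graded_mulX.
Qed.

Lemma graded_Qy Q c t i f : graded Q c t f ->
  graded Q c (t + sgy i * c (y_ i)) (Qy n2 i f).
Proof.
rewrite /sgn_lt /Qy; case: ifP => _ gf; first by rewrite mulN1r; apply: graded_der.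
by rewrite mul1r; apply: gradedN; apply: graded_mulX.
Qed.

Definition xy_vec (a b : 'I_n -> int) (u : 'I_(n + n)) : int :=
  match split u with inl i => a i | inr i => b i end.

Lemma xy_vec_x a b i : xy_vec a b (x_ i) = a i.
Proof. by rewrite /xy_vec (unsplitK (inl i)). Qed.

Lemma xy_vec_y a b i : xy_vec a b (y_ i) = b i.
Proof. by rewrite /xy_vec (unsplitK (inr i)). Qed.

Lemma mgrade_xy a b m :
  mgrade (xy_vec a b) m = \sum_i a i * (m (x_ i))%:Z + \sum_i b i * (m (y_ i))%:Z.
Proof.
rewrite /mgrade big_split_ord; congr (_ + _); apply: eq_bigr => i _.
  by rewrite xy_vec_x.
by rewrite xy_vec_y.
Qed.

Lemma xdeg_mgrade m : xdeg n1 m = mgrade (xy_vec sgx (fun=> 0)) m.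
Proof.
rewrite mgrade_xy [X in _ + X]big1 ?addr0; last by move=> i _; rewrite mul0r.
rewrite [RHS](bigID (fun i : 'I_n => (i < n1)%N)) /= addrC /xdeg -sumrN.
congr (_ + _); apply: congr_big => // i; rewrite /sgn_lt.
- by lia.
- by move=> iP; rewrite ltnNge iP mul1r.
- by move=> ->; rewrite mulN1r.
Qed.

Lemma ydeg_mgrade m : ydeg n2 m = mgrade (xy_vec (fun=> 0) (fun i => - sgy i)) m.
Proof.
rewrite mgrade_xy [X in X + _]big1 ?add0r; last by move=> i _; rewrite mul0r.
rewrite [RHS](bigID (fun i : 'I_n => (i < n2)%N)) /= /ydeg -sumrN.
congr (_ + _); apply: congr_big => // i; rewrite /sgn_lt.
- by move=> ->; rewrite mul1r.
- by lia.
- by move=> iP; rewrite ltnNge iP mulN1r.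
Qed.

Lemma BgrP l1 l2 f : Bgr n1 n2 l1 l2 f <->
  forall m, f@_m != 0 -> xdeg n1 m = l1 /\ ydeg n2 m = l2.
Proof.
split=> [[k [c [b [bP ->]]]] m|H].
  rewrite raddf_sum /= => /eqP; case: (pickP (fun i : 'I_k => (b i)@_m != 0)) => [i bi _|b0].
    have [p [px py bE]] := bP i; move: bi; rewrite bE mcoeffX.
    by case: (p =P m) => [<-|_]; rewrite ?eqxx.
  by case; apply: big1 => i _; rewrite mcoeffZ (eqP (negbFE (b0 i))) mulr0.
exists (size (msupp f)), (fun i : 'I_(size (msupp f)) => f@_(nth 0%MM (msupp f) i)),
  (fun i : 'I_(size (msupp f)) => 'X_[nth 0%MM (msupp f) i]); split.
  move=> i; exists (nth 0%MM (msupp f) i).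
  by have [] := H (nth 0%MM (msupp f) i); first by rewrite -mcoeff_msupp mem_nth.
by rewrite {1}[f]mpolyE (big_nth 0%MM) big_mkord.
Qed.

Lemma Bgr_graded l1 l2 f : Bgr n1 n2 l1 l2 f <->
  graded (eq^~ 0) (xy_vec sgx (fun=> 0)) l1 f /\
  graded (eq^~ 0) (xy_vec (fun=> 0) (fun i => - sgy i)) l2 f.
Proof.
rewrite BgrP; split=> [H|[Hx Hy] m fm].
  by split=> m /H[mx my]; rewrite -?xdeg_mgrade -?ydeg_mgrade ?mx ?my subrr.
by rewrite xdeg_mgrade ydeg_mgrade; split; apply/subr0_eq; [apply: Hx|apply: Hy].
Qed.

Lemma sgn_lt2 p i : sgn_lt p i * sgn_lt p i = 1.
Proof. by rewrite /sgn_lt; case: ifP. Qed.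

Lemma graded_PxQx Q c t i j f : graded Q c t f ->
  graded Q c (t + (sgx i * c (x_ i) - sgx j * c (x_ j))) (Px n1 i (Qx n1 j f)).
Proof. by rewrite addrCA addrC => gf; do ?[apply: graded_Px|apply: graded_Qx]. Qed.

Lemma graded_PyQy Q c t i j f : graded Q c t f ->
  graded Q c (t + (sgy j * c (y_ j) - sgy i * c (y_ i))) (Py n2 i (Qy n2 j f)).
Proof. by rewrite addrA => gf; apply: graded_Py; apply: graded_Qy. Qed.

Lemma graded_QxQy Q c t i f : graded Q c t f ->
  graded Q c (t + (sgy i * c (y_ i) - sgx i * c (x_ i))) (Qx n1 i (Qy n2 i f)).
Proof. by rewrite addrA => gf; apply: graded_Qx; apply: graded_Qy. Qed.

Lemma graded_PxPy Q c t i f : graded Q c t f ->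
  graded Q c (t + (sgx i * c (x_ i) - sgy i * c (y_ i))) (Px n1 i (Py n2 i f)).
Proof. by rewrite addrCA addrC => gf; apply: graded_Px; apply: graded_Py. Qed.

Lemma graded_Eop Q c t s i j f : graded Q c t f ->
  sgx i * c (x_ i) - sgx j * c (x_ j) = s -> sgy i * c (y_ i) - sgy j * c (y_ j) = s ->
  graded Q c (t + s) (Eop n1 n2 i j f).
Proof.
move=> gf sx sy; rewrite EopE; apply: gradedD.
  by rewrite -sx; apply: graded_PxQx.
by rewrite -sy; apply: gradedN; apply: graded_PyQy.
Qed.


Lemma Bgr_Eop l1 l2 i j f : Bgr n1 n2 l1 l2 f -> Bgr n1 n2 l1 l2 (Eop n1 n2 i j f).
Proof.
rewrite !Bgr_graded => -[/graded_Eop gx /graded_Eop gy]; split.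
  by rewrite -[l1]addr0; apply: gx; rewrite ?xy_vec_x ?xy_vec_y ?mulr0 ?sgn_lt2 subrr.
rewrite -[l2]addr0; apply: gy; rewrite ?xy_vec_x ?xy_vec_y ?mulr0 ?subrr //.
by rewrite !mulrN !sgn_lt2 subrr.
Qed.

Hypothesis n12 : (n1 <= n2)%N.

Lemma Bgr_Dop l1 l2 f : Bgr n1 n2 l1 l2 f -> Bgr n1 n2 (l1 - 1) (l2 - 1) (Dop n1 n2 f).
Proof.
rewrite !Bgr_graded DopE // => -[gx gy].
split; apply: graded_sum => i _.
  have := graded_QxQy (i := i) gx; rewrite xy_vec_x xy_vec_y mulr0 sgn_lt2 sub0r; exact.
by have := graded_QxQy (i := i) gy; rewrite xy_vec_x xy_vec_y mulr0 subr0 mulrN sgn_lt2.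
Qed.

Lemma Bgr_etaop l1 l2 f : Bgr n1 n2 l1 l2 f -> Bgr n1 n2 (l1 + 1) (l2 + 1) (etaop n1 n2 f).
Proof.
rewrite !Bgr_graded etaopE // => -[gx gy].
split; apply: graded_sum => i _.
  have := graded_PxPy (i := i) gx; rewrite xy_vec_x xy_vec_y mulr0 sgn_lt2 subr0; exact.
by have := graded_PxPy (i := i) gy; rewrite xy_vec_x xy_vec_y mulr0 sub0r mulrN sgn_lt2 opprK.
Qed.

(** Each term of D lowers exactly one of the exponents counted here, by one. *)
Definition Dheight := xy_vec (fun i => (n2 <= i)%:R) (fun i => (i < n2)%:R).

Lemma graded_Dop_height t f : graded (fun s => s <= 0) Dheight t f ->
  graded (fun s => s <= 0) Dheight (t - 1) (Dop n1 n2 f).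
Proof.
move=> gf; rewrite DopE //; apply: graded_sum => i _.
have := graded_QxQy (i := i) gf; congr (graded _ _ (_ + _) _).
rewrite /Dheight xy_vec_x xy_vec_y /sgn_lt.
by case: (ltnP i n1) => i1; case: (ltnP i n2) => i2 //; lia.
Qed.

Lemma Dop_nilpotent f : exists k, iter k (Dop n1 n2) f = 0.
Proof.
have Dh_ge0 m : 0 <= mgrade Dheight m.
  rewrite mgrade_xy; apply: addr_ge0; apply: sumr_ge0 => i _; by case: leqP.
pose N := (\max_(m <- msupp f) `|mgrade Dheight m|)%N.
have gf : graded (fun s => s <= 0) Dheight N%:Z f.
  move=> m; rewrite -mcoeff_msupp => fm.
  have : (`|mgrade Dheight m| <= N)%N.
    by apply: (@leq_bigmax_seq _ _ xpredT (fun m => `|mgrade Dheight m|%N)).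
  by have := Dh_ge0 m; lia.
exists N.+1; suff gk k : graded (fun s => s <= 0) Dheight (N%:Z - k%:Z) (iter k (Dop n1 n2) f).
  apply/mpolyP => m; rewrite mcoeff0; apply/eqP/negPn/negP => /(gk N.+1).
  by have := Dh_ge0 m; lia.
elim: k => [|k IH] /=; first by rewrite subr0.
by have -> : N%:Z - k.+1%:Z = N%:Z - k%:Z - 1 by [lia]; apply: graded_Dop_height.
Qed.
End Grading.

(** * Weights and divided-power coefficients *)

Section Weights.
Variables (F : fieldType) (n n1 n2 : nat).
Local Notation V := {mpoly F[n + n]}.
Implicit Types (f g : V) (m : 'X_{1..n + n}) (i j : 'I_n).

(** Eigenvalues on the monomial [m] of P_i Q_i, of P'_i Q'_i and of E_ii. *)
Definition wx i m : int := if (i < n1)%N then - (m (x_ i))%:Z - 1 else (m (x_ i))%:Z.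
Definition wy i m : int := if (i < n2)%N then (m (y_ i))%:Z else - (m (y_ i))%:Z - 1.
Definition wt i m : int := wx i m - wy i m.

Lemma coef_mulX_der (u : 'I_(n + n)) f m :
  ('X_u * f^`M(u))@_m = (m u)%:R * f@_m.
Proof.
rewrite coef_mulX; case: posnP => [->|mu]; first by rewrite mul0r.
have mE : (m - U_(u) + U_(u))%MM = m.
  by apply/mnmP=> v; rewrite !(mnmDE, mnmBE, mnm1E); case: eqP => [<-|_]; lia.
rewrite mcoeff_deriv mE -[LHS]mulr_natl mnmBE mnm1E eqxx.
by rewrite subn1 prednK.
Qed.

Lemma coef_PxQx i f m : (Px n1 i (Qx n1 i f))@_m = (wx i m)%:~R * f@_m.
Proof.
rewrite -ExE /Ex /wx; case: ifP => ii; rewrite ii; last by rewrite /xvar /dx coef_mulX_der.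
rewrite eqxx scale1r mcoeffB mcoeffN /xvar /dx coef_mulX_der.
by rewrite rmorphB rmorphN /= mulrBl mul1r mulNr.
Qed.

Lemma coef_PyQy i f m : (Py n2 i (Qy n2 i f))@_m = (wy i m)%:~R * f@_m.
Proof.
rewrite -EyE /Ey /wy; case: ifP => ii; rewrite ii; first by rewrite /yvar /dy coef_mulX_der.
rewrite eqxx scale1r mcoeffB mcoeffN /yvar /dy coef_mulX_der.
by rewrite rmorphB rmorphN /= mulrBl mul1r mulNr.
Qed.

Lemma coef_Eii i f m : (Eop n1 n2 i i f)@_m = (wt i m)%:~R * f@_m.
Proof. by rewrite EopE mcoeffB coef_PxQx coef_PyQy rmorphB mulrBl. Qed.

Hypothesis le_n : (n1 <= n2 <= n)%N.

Lemma sum_wx m : \sum_i wx i m = xdeg n1 m - n1%:Z.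
Proof.
rewrite xdeg_mgrade mgrade_xy [X in _ = _ + X - _]big1 => [|i _]; last by rewrite mul0r.
have cn1 : \sum_(i < n | (i < n1)%N) 1 = n1%:Z.
  have n1n : (n1 <= n)%N by lia.
  by rewrite -(big_ord_widen _ (fun=> 1) n1n) sumr_const card_ord natz.
rewrite addr0 -cn1 [X in _ - X]big_mkcond -sumrB; apply: eq_bigr => i _.
by rewrite /wx /sgn_lt; case: ifP => _; rewrite ?mulN1r ?mul1r ?subr0.
Qed.

Lemma sum_wy m : \sum_i wy i m = ydeg n2 m - (n - n2)%N%:Z.
Proof.
rewrite ydeg_mgrade mgrade_xy [X in _ = X + _ - _]big1 => [|i _]; last by rewrite mul0r.
have n2n : (n2 <= n)%N by lia.
have cn2 : \sum_(i < n | ~~ (i < n2)%N) 1 = (n - n2)%N%:Z.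
  have cn : \sum_(i < n) 1 = n%:Z by rewrite sumr_const card_ord natz.
  move: cn; rewrite (bigID (fun i : 'I_n => (i < n2)%N)) /=.
  rewrite -(big_ord_widen _ (fun=> 1) n2n) sumr_const card_ord natz.
  by rewrite -subzn // => <-; rewrite addrAC subrr add0r.
rewrite add0r -cn2 [X in _ - X]big_mkcond -sumrB; apply: eq_bigr => i _.
by rewrite /wy /sgn_lt; case: ifP => _; rewrite ?mulN1r ?mul1r ?opprK ?mul1r ?subr0 //= mulN1r.
Qed.

Lemma Dop_etaop_Bgr l1 l2 f : Bgr n1 n2 l1 l2 f ->
  Dop n1 n2 (etaop n1 n2 f)
  = etaop n1 n2 (Dop n1 n2 f) + (l1 + l2 + n2%:Z - n1%:Z)%:~R *: f.
Proof.
move/BgrP => Bf; rewrite Dop_etaop; last lia.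
congr (_ + _); apply/mpolyP => m; rewrite mcoeffZ raddf_sum /=.
under eq_bigr => i _ do rewrite !mcoeffD coef_PxQx coef_PyQy -{3}[f@_m]mul1r -!mulrDl.
rewrite -mulr_suml; have [->|fm] := eqVneq f@_m 0; first by rewrite !mulr0.
congr (_ * _); rewrite (eq_bigr (fun i => (wx i m + wy i m + 1)%:~R)); last first.
  by move=> i _; rewrite !rmorphD.
rewrite -(rmorph_sum (intr : int -> F)) /= !big_split /= sum_wx sum_wy sumr_const card_ord.
have [-> ->] := Bf m fm; congr _%:~R; rewrite natz; lia.
Qed.

Lemma sum_Eii l1 l2 f : Bgr n1 n2 l1 l2 f ->
  \sum_i Eop n1 n2 i i f = (l1 - n1%:Z - (l2 - (n - n2)%N%:Z))%:~R *: f.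
Proof.
move/BgrP => Bf; apply/mpolyP => m; rewrite mcoeffZ raddf_sum /=.
under eq_bigr => i _ do rewrite coef_Eii.
rewrite -mulr_suml; have [->|fm] := eqVneq f@_m 0; first by rewrite !mulr0.
congr (_ * _); rewrite -(rmorph_sum (intr : int -> F)) /= /wt sumrB sum_wx sum_wy.
by have [-> ->] := Bf m fm.
Qed.

End Weights.

Section DividedPowers.
Variables (F : fieldType) (n : nat).
Local Notation V := {mpoly F[n + n]}.
Implicit Types (f g : V) (m : 'X_{1..n + n}).

(** Scaling the coefficients by factorials turns a derivation into a shift of
    the exponent.  Multiplication by a variable becomes a shift with the factor
    [m u], which vanishes exactly where the truncated subtraction of [U_(u)] is
    not the true one; no case distinction is left. *)
Definition mfac m : nat := (\prod_u (m u)`!)%N.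
Definition dcoef f m : F := (mfac m)%:R * f@_m.

Lemma mfac_addU m u : mfac (m + U_(u))%MM = ((m u).+1 * mfac m)%N.
Proof.
rewrite /mfac (bigD1 u) //= [in RHS](bigD1 u) //= mulnA; congr (_ * _)%N.
  by rewrite mnmDE mnm1E eqxx addn1 factS.
by apply: eq_bigr => v /negbTE vu; rewrite mnmDE mnm1E eq_sym vu addn0.
Qed.

Lemma dcoef_der u f m : dcoef f^`M(u) m = dcoef f (m + U_(u))%MM.
Proof.
by rewrite /dcoef mcoeff_deriv mfac_addU natrM [LHS]mulrnAr -[LHS]mulr_natl mulrA.
Qed.

Lemma dcoef_mulX u f m : dcoef ('X_u * f) m = (m u)%:R * dcoef f (m - U_(u))%MM.
Proof.
rewrite /dcoef coef_mulX; case: posnP => [->|mu]; first by rewrite mulr0 mul0r.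
have {1}-> : m = (m - U_(u) + U_(u))%MM.
  by apply/mnmP=> v; rewrite !(mnmDE, mnmBE, mnm1E); case: eqP => [<-|_]; lia.
rewrite mfac_addU natrM mulrA; congr (_%:R * _ * _).
by rewrite mnmBE mnm1E eqxx; lia.
Qed.

Lemma dcoefD f g m : dcoef (f + g) m = dcoef f m + dcoef g m.
Proof. by rewrite /dcoef mcoeffD mulrDr. Qed.
Lemma dcoefN f m : dcoef (- f) m = - dcoef f m.
Proof. by rewrite /dcoef mcoeffN mulrN. Qed.
Lemma dcoefZ a f m : dcoef (a *: f) m = a * dcoef f m.
Proof. by rewrite /dcoef mcoeffZ mulrCA. Qed.
Lemma dcoef0 m : dcoef 0 m = 0.
Proof. by rewrite /dcoef mcoeff0 mulr0. Qed.
Lemma dcoef_sum (I : Type) (r : seq I) (P : pred I) (G : I -> V) m :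
  dcoef (\sum_(i <- r | P i) G i) m = \sum_(i <- r | P i) dcoef (G i) m.
Proof. by rewrite /dcoef raddf_sum mulr_sumr. Qed.

End DividedPowers.

(** * The contravariant form *)

Section Form.
Variables (F : fieldType) (n n1 n2 : nat).
Local Notation V := {mpoly F[n + n]}.
Implicit Types (f g : V) (m : 'X_{1..n + n}) (i j : 'I_n).

(** The sign attached to the transformed variables is what makes Q_i the
    transpose of P_i for them too. *)
Definition cform_sign (u : 'I_(n + n)) : F := match split u with
  | inl i => if (i < n1)%N then -1 else 1
  | inr i => if (i < n2)%N then 1 else -1 end.

Definition mnm_norm m : F := (\prod_u cform_sign u ^+ m u) * (mfac m)%:R.

Definition cform f g : F := \sum_(m <- msupp f) f@_m * mnm_norm m * g@_m.

Lemma cform_sign_x i : cform_sign (x_ i) = if (i < n1)%N then -1 else 1.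
Proof. by rewrite /cform_sign (unsplitK (inl i)). Qed.

Lemma cform_sign_y i : cform_sign (y_ i) = if (i < n2)%N then 1 else -1.
Proof. by rewrite /cform_sign (unsplitK (inr i)). Qed.

Lemma cform_sign2 u : cform_sign u * cform_sign u = 1.
Proof. by rewrite /cform_sign; case: split => i; case: ifP => _; rewrite ?mulrNN mulr1. Qed.

Lemma mnm_norm_neq0 m : [pchar F] =i pred0 -> mnm_norm m != 0.
Proof.
move=> /pcharf0P natF; rewrite mulf_neq0 //.
  apply/prodf_neq0 => u _; rewrite expf_neq0 //.
  by apply/eqP => u0; have := cform_sign2 u; rewrite u0 mul0r => /esym/eqP; rewrite oner_eq0.
rewrite natF -lt0n /mfac; apply: prodn_gt0 => u; exact: fact_gt0.
Qed.

Lemma mnm_norm_addU m u : mnm_norm (m + U_(u))%MM = cform_sign u * (m u).+1%:R * mnm_norm m.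
Proof.
rewrite /mnm_norm mfac_addU natrM (bigD1 u) //= [in RHS](bigD1 u) //=.
rewrite (eq_bigr (fun v => cform_sign v ^+ m v)); last first.
  by move=> v /negbTE vu; rewrite mnmDE mnm1E eq_sym vu addn0.
by rewrite mnmDE mnm1E eqxx addn1 exprS; ring.
Qed.

Lemma cform_seq f g (s : seq 'X_{1..n + n}) : uniq s -> {subset msupp f <= s} ->
  cform f g = \sum_(m <- s) f@_m * mnm_norm m * g@_m.
Proof.
move=> us fs; rewrite /cform [RHS](bigID (fun m => m \in msupp f)) /=.
rewrite [X in _ = _ + X]big1 => [|m]; last first.
  by rewrite mcoeff_msupp negbK => /eqP->; rewrite !mul0r.
rewrite addr0 -[RHS]big_filter; apply: perm_big; apply: uniq_perm.
- exact: msupp_uniq.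
- exact: filter_uniq.
- by move=> m; rewrite mem_filter; case: (boolP (m \in msupp f)) => [/fs|].
Qed.

Lemma cformC f g : cform f g = cform g f.
Proof.
have us := undup_uniq (msupp f ++ msupp g).
rewrite (cform_seq _ us) => [|m fm]; last by rewrite mem_undup mem_cat fm.
rewrite (cform_seq _ us) => [|m gm]; last by rewrite mem_undup mem_cat gm orbT.
by apply: eq_bigr => m _; ring.
Qed.

Lemma cform_linear_r f : linear_for *%R (cform f).
Proof.
move=> a g h; rewrite /cform mulr_sumr -big_split /=; apply: eq_bigr => m _.
by rewrite mcoeffD mcoeffZ; ring.
Qed.
HB.instance Definition _ f := GRing.isLinear.Build F V F *%R (cform f) (cform_linear_r f).

Lemma cformX m g : cform 'X_[m] g = mnm_norm m * g@_m.
Proof. by rewrite /cform msuppX big_seq1 mcoeffX eqxx mul1r. Qed.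

Lemma cform_mulX u f g : cform ('X_u * f) g = cform_sign u * cform f g^`M(u).
Proof.
rewrite cformC [cform f _]cformC [f]mpolyE mulr_sumr !linear_sum mulr_sumr /=.
apply: eq_bigr => m _; rewrite -scalerAr !linearZ /= mulrCA; congr (_ * _).
rewrite -mpolyXD addmC cformC [cform _ 'X_[m]]cformC !cformX mcoeff_deriv mnm_norm_addU.
by rewrite -mulr_natl; ring.
Qed.

Lemma cform_der u f g : cform f^`M(u) g = cform_sign u * cform f ('X_u * g).
Proof. by rewrite [cform f _]cformC cform_mulX mulrA cform_sign2 mul1r cformC. Qed.

Lemma cform_Px i f g : cform (Px n1 i f) g = cform f (Qx n1 i g).
Proof.
rewrite /Px /Qx; case: ifP => iP.
  by rewrite /dx cform_der cform_sign_x iP mulN1r linearN.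
by rewrite /xvar cform_mulX cform_sign_x iP mul1r.
Qed.

Lemma cform_Qx i f g : cform (Qx n1 i f) g = cform f (Px n1 i g).
Proof. by rewrite cformC -cform_Px cformC. Qed.

Lemma cform_Py i f g : cform (Py n2 i f) g = cform f (Qy n2 i g).
Proof.
rewrite /Py /Qy; case: ifP => iP.
  by rewrite /yvar cform_mulX cform_sign_y iP mul1r.
by rewrite /dy cform_der cform_sign_y iP mulN1r linearN.
Qed.

Lemma cform_Qy i f g : cform (Qy n2 i f) g = cform f (Py n2 i g).
Proof. by rewrite cformC -cform_Py cformC. Qed.

Lemma cform_linear_l g : linear_for *%R (cform^~ g).
Proof. by move=> a f h /=; rewrite !(cformC _ g) cform_linear_r. Qed.

Lemma cformZl a f g : cform (a *: f) g = a * cform f g.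
Proof. by rewrite !(cformC _ g) linearZ. Qed.

(** The form is contravariant: transposition exchanges P_i with Q_i and P'_i
    with Q'_i, hence E_ij with E_ji. *)
Lemma cform_Eop i j f g : cform (Eop n1 n2 i j f) g = cform f (Eop n1 n2 j i g).
Proof.
rewrite !EopE linearB cformC linearB /= !(cformC g).
by rewrite cform_Px cform_Qx cform_Py cform_Qy.
Qed.

Lemma cform_Dop f g : (n1 <= n2)%N -> cform (Dop n1 n2 f) g = cform f (etaop n1 n2 g).
Proof.
move=> n12; rewrite DopE // etaopE // cformC !linear_sum /=; apply: eq_bigr => i _.
by rewrite cformC cform_Qx cform_Qy Px_Py.
Qed.

End Form.

(** * Lowering and raising operators *)

Lemma intr_neq0 (F : fieldType) (z : int) : [pchar F] =i pred0 -> z != 0 -> z%:~R != 0 :> F.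
Proof.
move=> /pcharf0P natF; case: z => k k0; first by rewrite -pmulrn natF; lia.
by rewrite NegzE mulrNz oppr_eq0 -pmulrn natF.
Qed.

Section Subspace.
Variables (F : fieldType) (V : lmodType F) (U : V -> Prop).
Hypothesis subU : subspace U.

Lemma subspace0 : U 0. Proof. by case: subU. Qed.
Lemma subspaceZ a v : U v -> U (a *: v).
Proof. by move=> Uv; rewrite -[_ *: _]addr0; apply: subU.2 => //; apply: subspace0. Qed.
Lemma subspaceD u v : U u -> U v -> U (u + v).
Proof. by move=> Uu Uv; rewrite -[u]scale1r; apply: subU.2. Qed.
Lemma subspaceB u v : U u -> U v -> U (u - v).
Proof. by move=> Uu Uv; rewrite -scaleN1r; apply: subspaceD => //; apply: subspaceZ. Qed.
Lemma subspace_sum (I : Type) (r : seq I) (P : pred I) (f : I -> V) :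
  (forall i, P i -> U (f i)) -> U (\sum_(i <- r | P i) f i).
Proof.
move=> Uf; elim/big_rec: _ => [|i v Pi Uv]; first exact: subspace0.
by apply: subspaceD => //; apply: Uf.
Qed.
End Subspace.

(** An abstract ladder of levels [G j], lowered by [D] to [G j.+1] and raised by
    [e], on which the commutator of [D] and [e] is [c - 2 j]. *)
Section LoweringRaising.
Variables (F : fieldType) (charF0 : [pchar F] =i pred0) (V : lmodType F).
Variables (D e : {linear V -> V}) (G : nat -> V -> Prop) (c : int).
Hypothesis subG : forall j, subspace (G j).
Hypothesis DG : forall j f, G j f -> G j.+1 (D f).
Hypothesis eG : forall j f, G j.+1 f -> G j (e f).
Hypothesis comm : forall j f, G j.+1 f ->
  D (e f) = e (D f) + (c - j.+1%:Z *+ 2)%:~R *: f.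
Hypothesis c_le1 : c <= 1.
Hypothesis D_nil : forall f, exists k, iter k D f = 0.

Let K j f := G j f /\ D f = 0.

Lemma iter_linear (T : {linear V -> V}) k : linear (iter k T).
Proof. by move=> a u v; elim: k => //= k ->; rewrite linearP. Qed.

Lemma iter_linear0 (T : {linear V -> V}) k : iter k T 0 = 0.
Proof. by elim: k => //= k ->; rewrite linear0. Qed.

Lemma iter_linearZ (T : {linear V -> V}) k a u : iter k T (a *: u) = a *: iter k T u.
Proof. by rewrite -[a *: u]addr0 iter_linear iter_linear0 addr0. Qed.

Lemma iter_raise k i f : G (i + k)%N f -> G i (iter k e f).
Proof.
by elim: k i => [|k IH] i; rewrite ?addn0 // addnS -addSn => /IH /= /eG.
Qed.

Lemma iter_lower k i f : G i f -> G (i + k)%N (iter k D f).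
Proof. by move=> gf; elim: k => [|k IH] /=; rewrite ?addn0 // addnS; apply: DG. Qed.

Lemma lower_raise k i h : K (i + k.+1)%N h ->
  D (iter k.+1 e h) = (k.+1%:Z * (c - (i + k.+1)%N%:Z *+ 2 + k%:Z))%:~R *: iter k e h.
Proof.
elim: k i => [|k IH] i [gh Dh].
  rewrite /= (@comm i); last by rewrite -addn1.
  by rewrite Dh linear0 add0r mul1r addr0 addn1.
have Kh : K (i.+1 + k.+1)%N h by split; rewrite // addSnnS.
rewrite [iter k.+2 _ _]iterS (@comm i); last by apply: iter_raise; case: Kh.
rewrite (IH i.+1 Kh) linearZ /= -scalerDl -rmorphD /=; congr (_%:~R *: _).
by lia.
Qed.

(** The scalar is a product of integers [j * (c - 2 * (i + k) + j - 1)] with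
    [0 < j <= k], and the second factor is negative because [c <= 1]. *)
Lemma iter_lower_raise k i h : K (i + k)%N h ->
  exists2 s : F, s != 0 & iter k D (iter k e h) = s *: h.
Proof.
elim: k i => [|k IH] i Kh; first by exists 1; rewrite ?oner_eq0 ?scale1r.
have [|s s0 sE] := IH i.+1; first by rewrite addSnnS.
exists ((k.+1%:Z * (c - (i + k.+1)%N%:Z *+ 2 + k%:Z))%:~R * s).
  rewrite mulf_neq0 //; apply: intr_neq0 => //; apply: mulf_neq0 => //.
  by apply: ltr0_neq0; lia.
by rewrite iterSr (lower_raise Kh) iter_linearZ sE scalerA.
Qed.

Lemma iter_lower_raise0 k m i h : (m < k)%N -> K (i + m)%N h -> iter k D (iter m e h) = 0.
Proof.
move=> mk Kh; have [s _ sE] := iter_lower_raise Kh.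
rewrite -(subnK (ltnW mk)) iterD sE iter_linearZ.
have -> : (k - m)%N = (k - m).-1.+1 by lia.
by rewrite iterSr Kh.2 iter_linear0 scaler0.
Qed.

(** If D^(k+1) f = 0, then D^k f is in the kernel of D, and a multiple of
    e^k D^k f has the same image as f under D^k; subtract it and induct. *)
Lemma decompose k i f : G i f -> iter k D f = 0 ->
  exists u : nat -> V, (forall m, K (i + m)%N (u m)) /\ f = \sum_(m < k) iter m e (u m).
Proof.
elim: k f => [|k IH] f gf /= Df.
  exists (fun=> 0); split; last by rewrite big_ord0.
  by move=> m; split; [apply: subspace0 | rewrite linear0].
have Kg : K (i + k)%N (iter k D f) by split => //; apply: iter_lower.
have [s s0 sE] := iter_lower_raise Kg.
have Kg' : K (i + k)%N (s^-1 *: iter k D f).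
  by split; [apply: subspaceZ => //; case: Kg | rewrite linearZ /= Df scaler0].
have [||u [Ku uE]] := IH (f - iter k e (s^-1 *: iter k D f)).
- by apply: subspaceB => //; apply: iter_raise; case: Kg'.
- rewrite -scaleN1r addrC iter_linear !iter_linearZ sE !scalerA -mulrA mulVf //.
  by rewrite mulr1 scaleN1r addNr.
exists (fun m => if m == k then s^-1 *: iter k D f else u m); split.
  by move=> m; case: eqP => [->|].
rewrite big_ord_recr /= eqxx -[LHS](subrK (iter k e (s^-1 *: iter k D f))) uE.
congr (_ + _); apply: eq_bigr => m _.
by rewrite (ltn_eqF (ltn_ord m)).
Qed.

(** D^k kills every term of a relation except the last one. *)
Lemma independent k i (u : nat -> V) :
  (forall m, exists2 h, K (i + m)%N h & u m = iter m e h) ->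
  \sum_(m < k) u m = 0 -> forall m, (m < k)%N -> u m = 0.
Proof.
move=> uP; elim: k => [|k IH] // sum0.
have uk : u k = 0.
  have [h Kh uE] := uP k; have [s s0 sE] := iter_lower_raise Kh.
  have : iter k D (\sum_(m < k.+1) u m) = 0 by rewrite sum0 iter_linear0.
  rewrite big_ord_recr /= -[\sum_(_ < _) _]scale1r iter_linear scale1r uE sE.
  have -> : iter k D (\sum_(m < k) u m) = 0.
    elim/big_rec: _ => [|m v _ v0]; first exact: iter_linear0.
    rewrite -[u m]scale1r iter_linear v0 addr0 scale1r.
    by have [h' Kh' ->] := uP m; apply: iter_lower_raise0 Kh'.
  rewrite add0r => /eqP; rewrite scaler_eq0 (negbTE s0) => /eqP->.
  exact: iter_linear0.
move: sum0; rewrite big_ord_recr /= uk addr0 => /IH u0 m.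
by rewrite ltnS leq_eqVlt => /orP[/eqP->|/u0].
Qed.

Lemma split_kernel i f : G i f ->
  exists u v, [/\ K i u, G i.+1 v & f = u + e v].
Proof.
move=> gf; have [k Dk] := D_nil f; have [u [Ku ->]] := decompose gf Dk.
case: k {Dk} => [|k].
  exists 0, 0; rewrite big_ord0 linear0 addr0; split=> //; last exact: subspace0.
  by split; [apply: subspace0 | rewrite linear0].
exists (u 0), (\sum_(m < k) iter m e (u m.+1)); split.
- by rewrite -[i]addn0.
- apply: subspace_sum => // m _; apply: iter_raise.
  by case: (Ku m.+1); rewrite addnS.
- by rewrite big_ord_recl linear_sum.
Qed.

Lemma kernel_raise0 i f v : K i f -> G i.+1 v -> f = e v -> f = 0.
Proof.
move=> Kf gv fE; have [k Dk] := D_nil v; have [u [Ku vE]] := decompose gv Dk.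
pose w m := if m is m'.+1 then - iter m e (u m') else f.
apply: (@independent k.+1 i w _ _ 0) => //.
- case=> [|m]; first by exists f; rewrite ?addn0.
  exists (- u m); last by rewrite /w -!scaleN1r iter_linearZ.
  rewrite addnS -addSn; case: (Ku m) => gu Du; split.
    by rewrite -scaleN1r; apply: subspaceZ.
  by rewrite linearN /= Du oppr0.
rewrite big_ord_recl /= fE vE linear_sum sumrN /=.
by apply/subr0_eq; rewrite subr0 subrr.
Qed.

End LoweringRaising.

(** * Coefficients of singular vectors *)

(** The equations E_ij f = 0 for i < j, sorted by the position of i and j with
    respect to [n1] and [n2], and D f = 0, for the divided-power coefficients
    [psi] of f.  The signs are arranged so that exchanging x_i with y_{n+1-i}
    permutes the list. *)
Record singular_coefs (F : fieldType) (n n1 n2 : nat)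
    (psi : 'X_{1..n + n} -> F) : Prop := SingularCoefs {
  sing_low : forall i j : 'I_n, (i < j)%N -> (j < n1)%N -> forall m : 'X_{1..n + n},
    (m (x_ j))%:R * psi (m - U_(x_ j) + U_(x_ i))%MM
    + (m (y_ j))%:R * psi (m - U_(y_ j) + U_(y_ i))%MM = 0;
  sing_low_mid : forall i j : 'I_n, (i < n1)%N -> (n1 <= j < n2)%N -> forall m : 'X_{1..n + n},
    psi (m + U_(x_ i) + U_(x_ j))%MM
    = (m (y_ j))%:R * psi (m - U_(y_ j) + U_(y_ i))%MM;
  sing_low_high : forall i j : 'I_n, (i < n1)%N -> (n2 <= j)%N -> forall m : 'X_{1..n + n},
    psi (m + U_(x_ i) + U_(x_ j))%MM = psi (m + U_(y_ i) + U_(y_ j))%MM;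
  sing_mid : forall i j : 'I_n, (n1 <= i)%N -> (i < j)%N -> (j < n2)%N ->
    forall m : 'X_{1..n + n}, (m (x_ i))%:R * psi (m - U_(x_ i) + U_(x_ j))%MM
    = (m (y_ j))%:R * psi (m - U_(y_ j) + U_(y_ i))%MM;
  sing_mid_high : forall i j : 'I_n, (n1 <= i < n2)%N -> (n2 <= j)%N ->
    forall m : 'X_{1..n + n}, (m (x_ i))%:R * psi (m - U_(x_ i) + U_(x_ j))%MM
    = psi (m + U_(y_ i) + U_(y_ j))%MM;
  sing_high : forall i j : 'I_n, (n2 <= i)%N -> (i < j)%N -> forall m : 'X_{1..n + n},
    (m (x_ i))%:R * psi (m - U_(x_ i) + U_(x_ j))%MM
    + (m (y_ i))%:R * psi (m - U_(y_ i) + U_(y_ j))%MM = 0;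
  sing_D : forall m : 'X_{1..n + n},
    \sum_(i < n | (i < n1)%N) (m (x_ i))%:R * psi (m - U_(x_ i) + U_(y_ i))%MM
    + \sum_(s < n | (n2 <= s)%N) (m (y_ s))%:R * psi (m - U_(y_ s) + U_(x_ s))%MM
    = \sum_(r < n | (n1 <= r < n2)%N) psi (m + U_(x_ r) + U_(y_ r))%MM }.

Section Shape.
Variables (F : fieldType) (charF0 : [pchar F] =i pred0).
Variables (n n1 n2 : nat) (psi : 'X_{1..n + n} -> F).
Hypothesis S : singular_coefs n1 n2 psi.

Let natF k : (k%:R == 0 :> F) = (k == 0)%N.
Proof. by move/pcharf0P: charF0 => ->. Qed.

(** The coefficient of E_ia f at the monomial where a unit of x_i has moved to
    x_a: its second term carries the exponent of y_a as a factor. *)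
Lemma sing_x_low0 (a i : 'I_n) m :
  a.+1 = n1 -> (i < a)%N -> psi m != 0 -> m (y_ a) = 0%N -> m (x_ i) = 0%N.
Proof.
move=> an1 ia pm ma; apply/eqP; apply: contraNT pm => mi; apply/eqP.
have ia' : (a < n1)%N by lia.
have := sing_low S ia ia' (m - U_(x_ i) + U_(x_ a))%MM.
have -> : (m - U_(x_ i) + U_(x_ a) - U_(x_ a) + U_(x_ i))%MM = m by mnm_eq m.
coord; rewrite ma subn0 addn0 mul0r addr0 => /eqP.
by rewrite mulf_eq0 natF eqxx addn1 /= => /eqP.
Qed.


(** In D f = 0, at the monomial where a unit of y_a has moved to x_a, all terms
    but psi(m) have a smaller exponent of y_a. *)
Lemma sing_vanish_Y (a : 'I_n) : (n1 <= n2)%N -> a.+1 = n1 ->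
  (forall m : 'X_{1..n + n}, m (y_ a) = 0%N -> psi m = 0) -> forall m, psi m = 0.
Proof.
move=> n12 an1 H0 m; move: {2}(m (y_ a)) (erefl (m (y_ a))) => k.
elim: k m => [|k IH] m mk; first exact: H0.
have := sing_D S (m - U_(y_ a) + U_(x_ a))%MM.
have aP : (a < n1)%N by lia.
rewrite [RHS]big1 => [|r rP]; last by apply: IH; coord; lia.
rewrite [X in _ + X]big1 => [|s sP]; last by rewrite IH ?mulr0 //; coord; lia.
rewrite (bigD1 a) //= big1 ?addr0 => [|i /andP[ilt]]; last first.
  by rewrite -val_eqE /= => ia; rewrite IH ?mulr0 //; coord; lia.
have -> : (m - U_(y_ a) + U_(x_ a) - U_(x_ a) + U_(y_ a))%MM = m by mnm_eq m.
by coord => /eqP; rewrite mulf_eq0 natF subn0 eqxx addn1 /= => /eqP.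
Qed.

(** At the monomial where a unit of x_b has moved to y_b, two terms of D f = 0
    survive the induction; E_ab f = 0 identifies their coefficients, and there
    remains (m(x_a) + m(y_b) + 1) psi(m) = 0. *)
Lemma sing_vanish_X (a b : 'I_n) : (n1 <= n2)%N -> a.+1 = n1 -> b = n2 :> nat ->
  (forall m : 'X_{1..n + n}, m (y_ a) = 0%N -> m (x_ b) = 0%N -> psi m = 0) ->
  forall m : 'X_{1..n + n}, m (y_ a) = 0%N -> psi m = 0.
Proof.
move=> n12 an1 bn2 H0 m; move: {2}(m (x_ b)) (erefl (m (x_ b))) => k.
elim: k m => [|k IH] m mk ma; first exact: H0.
apply/eqP/negPn/negP=> pm.
have := sing_D S (m - U_(x_ b) + U_(y_ b))%MM.
have aP : (a < n1)%N by lia.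
have bP : (n2 <= b)%N by lia.
rewrite [RHS]big1 => [|r rP]; last by apply: IH; coord; lia.
rewrite (bigD1 a) //= big1 ?addr0 => [|i /andP[ilt]]; last first.
  rewrite -val_eqE /= => ia; coord.
  by rewrite (@sing_x_low0 a i m) ?mul0r //; lia.
rewrite (bigD1 b) //= big1 ?addr0 => [|s /andP[sn2]]; last first.
  by rewrite -val_eqE /= => sb; rewrite IH ?mulr0 //; coord; lia.
have -> : (m - U_(x_ b) + U_(y_ b) - U_(y_ b) + U_(x_ b))%MM = m by mnm_eq m.
coord; case: (posnP (m (x_ a))) => ma0.
  rewrite ma0 mul0r add0r => /eqP; rewrite mulf_eq0 natF eqxx (negbTE pm).
  by rewrite addn1.
have := @sing_low_high _ _ _ _ _ S a b _ _ (m - U_(x_ a) - U_(x_ b))%MM.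
have -> : (m - U_(x_ a) - U_(x_ b) + U_(x_ a) + U_(x_ b))%MM = m by mnm_eq m.
have -> : (m - U_(x_ a) - U_(x_ b) + U_(y_ a) + U_(y_ b))%MM
   = (m - U_(x_ b) + U_(y_ b) - U_(x_ a) + U_(y_ a))%MM by mnm_eq m.
move=> <-; [|lia|lia].
have -> : (b == a :> nat) = false by lia.
move/eqP; rewrite eqxx -mulrDl -natrD mulf_eq0 natF (negbTE pm) addn1; lia.
Qed.

(** With x_i positive and y_a = 0 a coefficient vanishes, by [sing_x_low0].  So
    D f = 0, where a unit of y_i has moved to x_i, relates psi(m) only to the
    coefficient obtained by further moving a unit of x_a to y_a, and that one
    is 0 by E_aj f = 0 for any j between n1 and n2. *)
Lemma sing_y_low0 (a i : 'I_n) (m : 'X_{1..n + n}) :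
  a.+1 = n1 -> (n1 < n2 <= n)%N -> (i < a)%N -> psi m != 0 ->
  m (y_ a) = 0%N -> m (y_ i) = 0%N.
Proof.
move=> an1 n12' ia pm ma; apply/eqP; apply: contraNT pm => mi; apply/eqP.
apply/eqP/negPn/negP=> pm.
have mxi := sing_x_low0 an1 ia pm ma.
have van (mu : 'X_{1..n + n}) : mu (y_ a) = 0%N -> mu (x_ i) != 0%N -> psi mu = 0.
  by move=> mua; apply: contraNeq => pmu; rewrite (sing_x_low0 an1 ia pmu mua).
have aP : (a < n1)%N by lia.
have iP : (i < n1)%N && (i != a) by rewrite -val_eqE /=; lia.
have := sing_D S (m - U_(y_ i) + U_(x_ i))%MM.
rewrite [RHS]big1 => [|r rP]; last by apply: van; coord; lia.
rewrite [X in _ + X]big1 => [|s sP]; last by rewrite van ?mulr0 //; coord; lia.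
rewrite (bigD1 a) //= (bigD1 i) //= big1 ?addr0; last first.
  move=> k /andP[/andP[kn1]]; rewrite -!val_eqE /= => ka ki; coord.
  have -> : (i == k :> nat) = false by lia.
  by rewrite (@sing_x_low0 a k m) ?mul0r //; lia.
have -> : (m - U_(y_ i) + U_(x_ i) - U_(x_ i) + U_(y_ i))%MM = m by mnm_eq m.
coord.
have [j jP] : exists j : 'I_n, (n1 <= j < n2)%N.
  by have jn : (n1 < n)%N by [lia]; exists (Ordinal jn) => /=; lia.
have := sing_low_mid S aP jP
  (m - U_(y_ i) + U_(x_ i) - U_(x_ a) + U_(y_ j))%MM.
rewrite [in LHS]van; try (coord; lia).
have -> : (m - U_(y_ i) + U_(x_ i) - U_(x_ a) + U_(y_ j) - U_(y_ j)
    + U_(y_ a))%MM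
  = (m - U_(y_ i) + U_(x_ i) - U_(x_ a) + U_(y_ a))%MM by mnm_eq m.
coord => /esym/eqP; rewrite eqxx addn1 mulf_eq0 natF /= => /eqP->.
rewrite mulr0 add0r => /eqP; rewrite mulf_eq0 natF (negbTE pm); lia.
Qed.

(** If the exponents of x_j and y_j are positive, remove one unit of each to get
    nu, and let chi be the coefficient where a unit of x_a has then moved to
    y_a.  The equations E_ar f = 0 express by chi the coefficients at
    nu + x_r + y_r for all middle indices r, the equations E_as f = 0 do so for
    those at nu - y_s + x_s, and D f = 0 becomes A chi = 0 with
    A = nu(x_a) + sum_s nu(y_s) - sum_r (nu(y_r) + 1).  The last hypothesis
    makes A positive, so chi = 0 and psi(m), a multiple of chi, vanishes.  If
    y_j = 0, then E_aj f = 0 alone gives psi(m) = 0. *)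
Lemma sing_mid_x0 (a j : 'I_n) (m : 'X_{1..n + n}) :
  a.+1 = n1 -> (n1 <= j < n2)%N -> psi m != 0 -> m (y_ a) = 0%N ->
  (0 < m (x_ a))%N ->
  (\sum_(r < n | n1 <= r < n2) (m (y_ r)).+1
     <= m (x_ a) + \sum_(s < n | n2 <= s) m (y_ s))%N ->
  m (x_ j) = 0%N.
Proof.
move=> an1 jP pm ma ka le_m; apply/eqP/negPn/negP=> mxj.
have aP : (a < n1)%N by lia.
have [myj|myj] := posnP (m (y_ j)).
  have := sing_low_mid S aP jP (m - U_(x_ a) - U_(x_ j))%MM.
  have -> : (m - U_(x_ a) - U_(x_ j) + U_(x_ a) + U_(x_ j))%MM = m by mnm_eq m.
  by coord; rewrite myj mul0r => /eqP; apply/negP.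
have [nu mE] : exists nu, m = (nu + U_(x_ j) + U_(y_ j))%MM.
  by exists (m - U_(x_ j) - U_(y_ j))%MM; mnm_eq m.
set chi := psi (nu - U_(x_ a) + U_(y_ a))%MM.
have nuxa : nu (x_ a) = m (x_ a) by rewrite mE; coord; lia.
have mid_chi (r : 'I_n) : (n1 <= r < n2)%N ->
    psi (nu + U_(x_ r) + U_(y_ r))%MM = (nu (y_ r)).+1%:R * chi.
  move=> rP; have := sing_low_mid S aP rP (nu - U_(x_ a) + U_(y_ r))%MM.
  have -> : (nu - U_(x_ a) + U_(y_ r) + U_(x_ a) + U_(x_ r))%MM
     = (nu + U_(x_ r) + U_(y_ r))%MM by mnm_eq nu.
  move=> ->; congr (_%:R * psi _); last by mnm_eq nu.
  by coord; lia.
have chi0 : chi != 0.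
  apply: contraNneq pm => chi0.
  by rewrite mE mid_chi // chi0 mulr0.
have := sing_D S nu.
rewrite (bigD1 a) //= big1 ?addr0 => [|i /andP[ilt]]; last first.
  rewrite -val_eqE /= => ia.
  have : m (x_ i) = 0%N by apply: (@sing_x_low0 a); lia.
  by rewrite mE; coord => /eqP; rewrite !addn_eq0 => /andP[/andP[/eqP-> _] _]; rewrite mul0r.
rewrite (eq_bigr (fun s => (nu (y_ s))%:R * chi)); last first.
  move=> s sP; have [->|nus] := posnP (nu (y_ s)); first by rewrite !mul0r.
  congr (_ * _).
  have := sing_low_high S aP sP (nu - U_(x_ a) - U_(y_ s))%MM.
  have -> : (nu - U_(x_ a) - U_(y_ s) + U_(x_ a) + U_(x_ s))%MM
     = (nu - U_(y_ s) + U_(x_ s))%MM by mnm_eq nu.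
  by move=> ->; congr psi; mnm_eq nu.
rewrite (eq_bigr _ mid_chi) -!mulr_suml -mulrDl -!natr_sum -natrD => /(mulIf chi0) /eqP.
have eqn k l : (k%:R == l%:R :> F) = (k == l).
  wlog kl : k l / (k <= l)%N => [H|].
    by have [/H//|/ltnW/H] := leqP k l; rewrite eq_sym => ->; rewrite eq_sym.
  by rewrite eq_sym -subr_eq0 -natrB // natF; lia.
rewrite eqn nuxa => /eqP eq_nu.
have : (\sum_(s < n | n2 <= s) nu (y_ s) = \sum_(s < n | n2 <= s) m (y_ s))%N.
  by apply: eq_bigr => s sP; rewrite mE; coord; lia.
have : (\sum_(r < n | n1 <= r < n2) (nu (y_ r)).+1
        < \sum_(r < n | n1 <= r < n2) (m (y_ r)).+1)%N.
  rewrite (bigD1 j) //= [X in (_ < X)%N](bigD1 j) //= -addSn leq_add //.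
    by rewrite mE; coord; lia.
  by apply: leq_sum => r _; rewrite mE; coord; lia.
by move=> lt_nu eq_m; move: le_m; rewrite -eq_m eq_nu leqNgt lt_nu.
Qed.

Lemma sing_mid_y0 (i j : 'I_n) (m : 'X_{1..n + n}) :
  (n1 <= i)%N -> (i < j)%N -> (j < n2)%N -> psi m != 0 -> m (x_ i) = 0%N ->
  m (y_ i) = 0%N.
Proof.
move=> iP ij jP pm mxi; apply/eqP; apply: contraNT pm => myi; apply/eqP.
have := sing_mid S iP ij jP (m - U_(y_ i) + U_(y_ j))%MM.
have -> : (m - U_(y_ i) + U_(y_ j) - U_(y_ j) + U_(y_ i))%MM = m by mnm_eq m.
coord; rewrite mxi mul0r => /esym/eqP; rewrite mulf_eq0 natF eqxx => /orP[|/eqP//].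
by rewrite addn1.
Qed.

Lemma sing_y_low1 (a a' i : 'I_n) (m : 'X_{1..n + n}) :
  a.+1 = n1 -> a'.+1 = a -> (i < a')%N -> psi m != 0 ->
  m (y_ a) = 0%N -> m (y_ i) = 0%N.
Proof.
move=> an1 a'a ia pm ma; have a'P : (a' < n1)%N by lia.
apply/eqP; apply/negPn/negP => myi.
have := sing_low S ia a'P (m - U_(y_ i) + U_(y_ a'))%MM.
have -> : (m - U_(y_ i) + U_(y_ a') - U_(y_ a') + U_(y_ i))%MM = m by mnm_eq m.
coord; rewrite (@sing_x_low0 a a' m) //; last lia.
rewrite mul0r add0r => /eqP; rewrite mulf_eq0 natF eqxx (negbTE pm) addn1; lia.
Qed.

(** E_is f = 0 replaces a unit of y_i and of y_s by one of x_i and of x_s, and a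
    monomial with x_i positive and y_a = 0 has coefficient 0. *)
Lemma sing_y_low_high (a i s : 'I_n) (m : 'X_{1..n + n}) :
  (n1 <= n2)%N -> a.+1 = n1 -> (i < a)%N -> (n2 <= s)%N -> psi m != 0 ->
  m (y_ a) = 0%N -> (0 < m (y_ i))%N -> m (y_ s) = 0%N.
Proof.
move=> n12 an1 ia sP pm ma myi; have iP : (i < n1)%N by lia.
apply/eqP; apply: contraNT pm => mys; apply/eqP.
have := sing_low_high S iP sP (m - U_(y_ i) - U_(y_ s))%MM.
have -> : (m - U_(y_ i) - U_(y_ s) + U_(y_ i) + U_(y_ s))%MM = m by mnm_eq m.
move=> <-; apply/eqP/negPn/negP => pm; move: (sing_x_low0 an1 ia pm).
coord; lia.
Qed.

End Shape.

(** The symmetry exchanging x_i with y_{n+1-i}; [n1] and [n2] become [n - n2] and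
    [n - n1].  On the index set of all the variables it is the order reversal. *)
Definition mirror (n : nat) (m : 'X_{1..n + n}) : 'X_{1..n + n} :=
  [multinom m (rev_ord k) | k < n + n].

Lemma rev_x (n : nat) (i : 'I_n) : rev_ord (x_ i : 'I_(n + n)) = y_ (rev_ord i).
Proof. by apply: val_inj => /=; ord_bounds; lia. Qed.

Lemma rev_y (n : nat) (i : 'I_n) : rev_ord (y_ i : 'I_(n + n)) = x_ (rev_ord i).
Proof. by apply: val_inj => /=; ord_bounds; lia. Qed.

Lemma mirror_x (n : nat) (m : 'X_{1..n + n}) i : mirror m (x_ i) = m (y_ (rev_ord i)).
Proof. by rewrite mnmE rev_x. Qed.

Lemma mirror_y (n : nat) (m : 'X_{1..n + n}) i : mirror m (y_ i) = m (x_ (rev_ord i)).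
Proof. by rewrite mnmE rev_y. Qed.

Lemma mirrorK (n : nat) : involutive (@mirror n).
Proof. by move=> m; apply/mnmP => k; rewrite !mnmE rev_ordK. Qed.

Lemma mirrorU (n : nat) (u : 'I_(n + n)) : mirror U_(u) = U_(rev_ord u)%MM.
Proof. by apply/mnmP => k; rewrite !mnmE (can2_eq rev_ordK rev_ordK). Qed.

Lemma mirrorD (n : nat) (m p : 'X_{1..n + n}) :
  mirror (m + p) = (mirror m + mirror p)%MM.
Proof. by apply/mnmP => k; rewrite !mnmE. Qed.

Lemma mirrorB (n : nat) (m p : 'X_{1..n + n}) :
  mirror (m - p) = (mirror m - mirror p)%MM.
Proof. by apply/mnmP => k; rewrite !mnmE. Qed.

Lemma mirror_singular (F : fieldType) (n n1 n2 : nat) (psi : 'X_{1..n + n} -> F) :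
  (n1 <= n2 <= n)%N -> singular_coefs n1 n2 psi ->
  singular_coefs (n - n2) (n - n1) (psi \o @mirror n).
Proof.
move=> le_n S.
have E := (mirrorD, mirrorB, mirrorU, rev_x, rev_y).
have C := (mirror_x, mirror_y, @rev_ordK n).
split=> [i j ij jP m|i j iP jP m|i j iP jP m|i j iP ij jP m|i j iP jP m|i j iP ij m|m];
  rewrite /= ?E; ord_bounds.
- have /= := @sing_high _ _ _ _ _ S (rev_ord j) (rev_ord i) _ _ (mirror m).
  rewrite !C => R; rewrite addrC; apply: R; lia.
- have /= := @sing_mid_high _ _ _ _ _ S (rev_ord j) (rev_ord i) _ _ (mirror m).
  rewrite !C => ->; [congr psi; mnm_eq m|lia|lia].
- have /= := @sing_low_high _ _ _ _ _ S (rev_ord j) (rev_ord i) _ _ (mirror m).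
  move=> R; rewrite [LHS](_ : _ = psi (mirror m + U_(y_ (rev_ord j)) + U_(y_ (rev_ord i)))%MM).
    by rewrite -R; [congr psi; mnm_eq m|lia|lia].
  by congr psi; mnm_eq m.
- have /= := @sing_mid _ _ _ _ _ S (rev_ord j) (rev_ord i) _ _ _ (mirror m).
  by rewrite !C => R; symmetry; apply: R; lia.
- have /= := @sing_low_mid _ _ _ _ _ S (rev_ord j) (rev_ord i) _ _ (mirror m).
  rewrite !C => <-; [congr psi; mnm_eq m|lia|lia].
- have /= := @sing_low _ _ _ _ _ S (rev_ord j) (rev_ord i) _ _ (mirror m).
  rewrite !C => R; rewrite addrC; apply: R; lia.
have := sing_D S (mirror m).
rewrite [X in X + _](reindex_inj (@rev_ord_inj n)) [X in _ + X](reindex_inj (@rev_ord_inj n)).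
rewrite [RHS](reindex_inj (@rev_ord_inj n)) /= addrC => R.
rewrite [X in X + _](eq_bigl (fun i : 'I_n => (n2 <= n - i.+1)%N)); last first.
  by move=> i /=; ord_bounds; lia.
rewrite [X in _ + X](eq_bigl (fun i : 'I_n => (n - i.+1 < n1)%N)); last first.
  by move=> i /=; ord_bounds; lia.
rewrite [RHS](eq_bigl (fun i : 'I_n => (n1 <= n - i.+1 < n2)%N)); last first.
  by move=> i /=; ord_bounds; lia.
move: R; congr (_ + _ = _); apply: eq_bigr => i _; rewrite ?E ?C //.
by congr psi; mnm_eq m.
Qed.

(** The mirror images of the previous lemmas, with the index [b = n2] in the role
    of [a]. *)
Section Mirrored.
Variables (F : fieldType) (charF0 : [pchar F] =i pred0).
Variables (n n1 n2 : nat) (le_n : (n1 <= n2 <= n)%N) (psi : 'X_{1..n + n} -> F).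
Hypothesis S : singular_coefs n1 n2 psi.
Let n12 : (n - n2 <= n - n1)%N. Proof. lia. Qed.
Let S' := mirror_singular le_n S.
Let revK := @rev_ordK n.

Let psiM (m : 'X_{1..n + n}) : psi m != 0 -> (psi \o @mirror n) (mirror m) != 0.
Proof. by rewrite /= mirrorK. Qed.

Lemma sing_y_high0 (b s : 'I_n) (m : 'X_{1..n + n}) :
  b = n2 :> nat -> (b < s)%N -> psi m != 0 -> m (x_ b) = 0%N -> m (y_ s) = 0%N.
Proof.
move=> bn2 bs /psiM pm mb.
have := @sing_x_low0 _ charF0 _ _ _ _ S' (rev_ord b) (rev_ord s) _ _ _ pm.
by rewrite mirror_x mirror_y !revK; apply => //=; ord_bounds; lia.
Qed.

Lemma sing_x_high0 (b s : 'I_n) (m : 'X_{1..n + n}) :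
  b = n2 :> nat -> (n1 < n2)%N -> (b < s)%N -> psi m != 0 -> m (x_ b) = 0%N ->
  m (x_ s) = 0%N.
Proof.
move=> bn2 n12' bs /psiM pm mb.
have := @sing_y_low0 _ charF0 _ _ _ _ S' (rev_ord b) (rev_ord s) _ _ _ _ pm.
by rewrite !mirror_y !revK; apply => //=; ord_bounds; lia.
Qed.

Lemma sing_mid_x0_last (i j : 'I_n) (m : 'X_{1..n + n}) :
  (n1 <= i)%N -> (i < j)%N -> (j < n2)%N -> psi m != 0 -> m (y_ j) = 0%N ->
  m (x_ j) = 0%N.
Proof.
move=> iP ij jP /psiM pm mb.
have := @sing_mid_y0 _ charF0 _ _ _ _ S' (rev_ord j) (rev_ord i) _ _ _ _ pm.
by rewrite mirror_x mirror_y !revK; apply => //=; ord_bounds; lia.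
Qed.

Lemma sing_x_high1 (b b' s : 'I_n) (m : 'X_{1..n + n}) :
  b = n2 :> nat -> b' = b.+1 :> nat -> (b' < s)%N -> psi m != 0 ->
  m (x_ b) = 0%N -> m (x_ s) = 0%N.
Proof.
move=> bn2 b'b bs /psiM pm mb.
have := @sing_y_low1 _ charF0 _ _ _ _ S' (rev_ord b) (rev_ord b') (rev_ord s) _ _ _ _ pm.
by rewrite !mirror_y !revK; apply => //=; ord_bounds; lia.
Qed.

Lemma sing_x_low_high (b s i : 'I_n) (m : 'X_{1..n + n}) :
  b = n2 :> nat -> (b < s)%N -> (i < n1)%N -> psi m != 0 ->
  m (x_ b) = 0%N -> (0 < m (x_ s))%N -> m (x_ i) = 0%N.
Proof.
move=> bn2 bs iP /psiM pm mb ms.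
have := @sing_y_low_high _ charF0 _ _ _ _ S' (rev_ord b) (rev_ord s) (rev_ord i) _ n12 _ _ _ pm.
by rewrite !mirror_y !revK; apply => //=; ord_bounds; lia.
Qed.

Lemma sing_mid_y0_all (b j : 'I_n) (m : 'X_{1..n + n}) :
  b = n2 :> nat -> (n1 <= j < n2)%N -> psi m != 0 -> m (x_ b) = 0%N ->
  (0 < m (y_ b))%N ->
  (\sum_(r < n | n1 <= r < n2) (m (x_ r)).+1
     <= m (y_ b) + \sum_(i < n | i < n1) m (x_ i))%N ->
  m (y_ j) = 0%N.
Proof.
move=> bn2 jP /psiM pm mb mb0 le_m.
have := @sing_mid_x0 _ charF0 _ _ _ _ S' (rev_ord b) (rev_ord j) _ _ _ pm.
rewrite !mirror_y !mirror_x !revK; apply => //=; try (ord_bounds; lia).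
rewrite (reindex_inj (@rev_ord_inj n)) [X in (_ <= _ + X)%N](reindex_inj (@rev_ord_inj n)) /=.
rewrite (eq_bigl (fun i : 'I_n => (n1 <= i < n2)%N)); last first.
  by move=> i /=; ord_bounds; lia.
rewrite [X in (_ <= _ + X)%N](eq_bigl (fun i : 'I_n => (i < n1)%N)); last first.
  by move=> i /=; ord_bounds; lia.
under eq_bigr => i _ do rewrite mirror_y revK.
by under [X in (_ <= _ + X)%N]eq_bigr => i _ do rewrite mirror_y revK.
Qed.

End Mirrored.

Definition pos_part (l : int) : nat := if l is Posz k then k else 0.
Definition neg_part (l : int) : nat := if l is Negz k then k.+1 else 0.

(** Exponents of the monomial free of y_{n1} and x_{n2+1} in the highest weight
    vector: the absolute values of the negative parts of l1, l2 for x_{n1} and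
    y_{n2+1}; the positive parts for x_{n1+1} and y_{n2} if n1 < n2, but for
    x_{n1+2} and y_{n1-1} if n1 = n2. *)
Definition hw_mnm (n n1 n2 : nat) (l1 l2 : int) : 'X_{1..n + n} :=
  [multinom match split k with
    | inl i => if i.+1 == n1 then neg_part l1
               else if i == n1 + (n1 == n2) :> nat then pos_part l1 else 0
    | inr i => if i == n2 :> nat then neg_part l2
               else if (i.+1 + (n1 == n2))%N == n2 then pos_part l2 else 0
    end%N | k < n + n].

Definition lowest (n n1 n2 : nat) (m : 'X_{1..n + n}) : Prop :=
  (forall a : 'I_n, a.+1 = n1 -> m (y_ a) = 0%N) /\
  (forall b : 'I_n, b = n2 :> nat -> m (x_ b) = 0%N).

Lemma sum_only (n : nat) (P : pred 'I_n) (f : 'I_n -> nat) j : P j ->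
  (forall i, P i -> i != j :> nat -> f i = 0%N) ->
  (\sum_(i < n | P i) f i = f j)%N.
Proof.
move=> Pj f0; rewrite (bigD1 j) //= big1 ?addn0 // => i /andP[Pi].
by rewrite -val_eqE => /f0; apply.
Qed.

Lemma xdeg_nat (n n1 n2 : nat) (m : 'X_{1..n + n}) : (n1 <= n2)%N ->
  xdeg n1 m = (\sum_(r < n | n1 <= r < n2) m (x_ r)
     + \sum_(s < n | n2 <= s) m (x_ s))%N%:Z - (\sum_(i < n | i < n1) m (x_ i))%N%:Z.
Proof.
move=> n12; rewrite /xdeg -!(big_morph Posz PoszD (erefl _)); congr (Posz _ - _).
rewrite (bigID (fun i : 'I_n => (i < n2)%N)) /=; congr (_ + _)%N.
by apply: eq_bigl => i; lia.
Qed.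

Lemma ydeg_nat (n n1 n2 : nat) (m : 'X_{1..n + n}) : (n1 <= n2)%N ->
  ydeg n2 m = (\sum_(i < n | i < n1) m (y_ i)
     + \sum_(r < n | n1 <= r < n2) m (y_ r))%N%:Z
     - (\sum_(s < n | n2 <= s) m (y_ s))%N%:Z.
Proof.
move=> n12; rewrite /ydeg -!(big_morph Posz PoszD (erefl _)); congr (Posz _ - _).
rewrite (bigID (fun i : 'I_n => (i < n1)%N)) /=; congr (_ + _)%N.
  by apply: eq_bigl => i; lia.
by apply: eq_bigl => i; lia.
Qed.

Lemma sum_mid_succ (n n1 n2 : nat) (f : 'I_n -> nat) : (n2 <= n)%N ->
  (\sum_(r < n | n1 <= r < n2) (f r).+1
   = n2 - n1 + \sum_(r < n | n1 <= r < n2) f r)%N.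
Proof.
move=> n2n; under eq_bigr => r _ do rewrite -add1n.
rewrite big_split /=; congr addn.
rewrite -[RHS]muln1 -sum_nat_const_nat (big_nat_widen _ _ _ _ _ n2n).
by rewrite (big_nat_widenl _ 0) // big_mkord; apply: eq_bigl => i; rewrite andbC.
Qed.

Lemma hw_mnm_x (n n1 n2 : nat) (l1 l2 : int) (i : 'I_n) :
  hw_mnm n n1 n2 l1 l2 (x_ i) = (if i.+1 == n1 then neg_part l1
    else if i == n1 + (n1 == n2) :> nat then pos_part l1 else 0)%N.
Proof. by rewrite mnmE (unsplitK (inl i)). Qed.

Lemma hw_mnm_y (n n1 n2 : nat) (l1 l2 : int) (i : 'I_n) :
  hw_mnm n n1 n2 l1 l2 (y_ i) = (if i == n2 :> nat then neg_part l2
    else if (i.+1 + (n1 == n2))%N == n2 then pos_part l2 else 0)%N.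
Proof. by rewrite mnmE (unsplitK (inr i)). Qed.

Lemma mnm_xyP (n : nat) (m p : 'X_{1..n + n}) :
  (forall i : 'I_n, m (x_ i) = p (x_ i)) -> (forall i : 'I_n, m (y_ i) = p (y_ i)) ->
  m = p.
Proof. by move=> mx my; apply/mnmP => k; case: (split_ordP k) => i ->. Qed.

Section Uniqueness.
Variables (F : fieldType) (charF0 : [pchar F] =i pred0).
Variables (n n1 n2 : nat) (n1_gt0 : (0 < n1)%N) (le_n : (n1 <= n2 <= n)%N).
Variables (psi : 'X_{1..n + n} -> F).
Hypothesis S : singular_coefs n1 n2 psi.
Let n12 : (n1 <= n2)%N. Proof. lia. Qed.

Let a_ex : exists a : 'I_n, a.+1 = n1.
Proof. by have an : (n1.-1 < n)%N by [lia]; exists (Ordinal an) => /=; lia. Qed.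

Let ord_ex k : (k < n)%N -> exists b : 'I_n, b = k :> nat.
Proof. by move=> kn; exists (Ordinal kn). Qed.

Lemma lowest_vanish : (forall m, lowest n1 n2 m -> psi m = 0) -> forall m, psi m = 0.
Proof.
move=> H0; have [a an1] := a_ex.
have eqa (a' : 'I_n) : a'.+1 = n1 -> a' = a by move=> ?; apply: val_inj => /=; lia.
apply: (sing_vanish_Y charF0 S n12 an1) => m ma.
have [n2n|nn2] := ltnP n2 n; last first.
  by apply: H0; split=> [a' /eqa->//|b]; ord_bounds; lia.
have [b bn2] := ord_ex n2n.
move: m ma; apply: (sing_vanish_X charF0 S n12 an1 bn2) => m ma mb.
apply: H0; split=> [a' /eqa->//|b' bb'].
by rewrite (_ : b' = b) //; apply: val_inj => /=; lia.
Qed.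

Variables (l1 l2 : int).
Hypothesis l_le : l1 + l2 <= n1%:Z - n2%:Z + 1 - (n1 == n2)%:Z.

(** All exponents vanish except those of x_{n1}, y_{n2+1} and of the middle
    variables.  Let k, K be the first two, p and q the sums of the middle
    exponents of the x's and of the y's, so that l1 = p - k and l2 = q - K.  By
    [sing_mid_x0] and its mirror image, whose last hypothesis follows from the
    bound on l1 + l2, k > 0 forces p = 0 and K > 0 forces q = 0; if
    k = K = 0 the bound gives p + q = 0.  Finally, a middle exponent can be
    positive only at one end of the middle range. *)
Lemma lowest_unique_lt (m : 'X_{1..n + n}) : (n1 < n2)%N ->
  xdeg n1 m = l1 -> ydeg n2 m = l2 -> lowest n1 n2 m -> psi m != 0 ->
  m = hw_mnm n n1 n2 l1 l2.
Proof.
move=> n12' ml1 ml2 [ma mb] pm.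
have [a an1] := a_ex; have {}ma := ma a an1.
have eqa (a' : 'I_n) : a'.+1 = n1 -> a' = a by move=> ?; apply: val_inj => /=; lia.
have xlow (i : 'I_n) : (i < a)%N -> m (x_ i) = 0%N by move=> ?; apply: (sing_x_low0 charF0 S an1).
have ylow (i : 'I_n) : (i < n1)%N -> m (y_ i) = 0%N.
  move=> iP; have [ia|ai] := ltnP i a; first by apply: (sing_y_low0 charF0 S an1) => //; lia.
  by rewrite (eqa i) //; lia.
have xhigh (s : 'I_n) : (n2 <= s)%N -> m (x_ s) = 0%N.
  move=> sP; have [b bn2] : exists b : 'I_n, b = n2 :> nat by apply: ord_ex; ord_bounds; lia.
  have [bs|sb] := ltnP b s; first by apply: (sing_x_high0 charF0 le_n S bn2) => //; apply: mb.
  by apply: mb; lia.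
have yhigh (s : 'I_n) : (n2 < s)%N -> m (y_ s) = 0%N.
  move=> sP; have [b bn2] : exists b : 'I_n, b = n2 :> nat by apply: ord_ex; ord_bounds; lia.
  by apply: (sing_y_high0 charF0 le_n S bn2) => //; [lia | apply: mb].
move: ml1 ml2; rewrite (xdeg_nat _ n12) (ydeg_nat _ n12).
have sumxlow : (\sum_(i < n | i < n1) m (x_ i) = m (x_ a))%N.
  by apply: sum_only => [|i iP ia]; [lia | apply: xlow; lia].
have sumylow : (\sum_(i < n | i < n1) m (y_ i) = 0)%N by apply: big1 => i /ylow.
have sumxhigh : (\sum_(s < n | n2 <= s) m (x_ s) = 0)%N by apply: big1 => i /xhigh.
rewrite sumxlow sumylow sumxhigh addn0 add0n.
have sumyhigh (b : 'I_n) : b = n2 :> nat -> (\sum_(s < n | n2 <= s) m (y_ s) = m (y_ b))%N.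
  by move=> bn2; apply: sum_only => [|s sP sb]; [lia | apply: yhigh; lia].
have K0 : (\sum_(s < n | n2 <= s) m (y_ s) = 0)%N \/
    exists2 b : 'I_n, b = n2 :> nat & (\sum_(s < n | n2 <= s) m (y_ s) = m (y_ b))%N.
  have [n2n|nn2] := ltnP n2 n; last by left; apply: big1 => s sP; ord_bounds; lia.
  by have [b bn2] := ord_ex n2n; right; exists b => //; apply: sumyhigh.
move: K0 (@sing_mid_x0 _ charF0 _ _ _ _ S a) (@sing_mid_y0_all _ charF0 _ _ _ le_n _ S).
have n2n : (n2 <= n)%N by lia.
set p := (\sum_(r < n | n1 <= r < n2) m (x_ r))%N.
set q := (\sum_(r < n | n1 <= r < n2) m (y_ r))%N.
set K := (\sum_(s < n | n2 <= s) m (y_ s))%N.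
move=> K0 Hx Hy pl1 ql2.
have p_le (r : 'I_n) : (n1 <= r < n2)%N -> (m (x_ r) <= p)%N.
  by move=> rP; rewrite /p (bigD1 r) //= leq_addr.
have q_le (r : 'I_n) : (n1 <= r < n2)%N -> (m (y_ r) <= q)%N.
  by move=> rP; rewrite /q (bigD1 r) //= leq_addr.
have kp : (0 < m (x_ a))%N -> p = 0%N.
  move=> k0; have [//|p0] := posnP p; apply: big1 => r rP.
  apply: (Hx _ m) => //; rewrite sum_mid_succ // -/K -/q; lia.
have Kq : (0 < K)%N -> q = 0%N.
  move=> k0; have [//|q0] := posnP q; apply: big1 => r rP.
  case: K0 => [K0|[b bn2 Kb]]; first lia.
  apply: (Hy b _ m) => //; [exact: mb|lia|].
  rewrite sum_mid_succ // -/p sumxlow; lia.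
have yhigh' (s : 'I_n) : (n2 <= s)%N -> m (y_ s) = if s == n2 :> nat then K else 0%N.
  by move=> sP; case: eqP => [/sumyhigh//|sn]; apply: yhigh; lia.
have xmid (r : 'I_n) : (n1 <= r < n2)%N -> m (x_ r) = if r == n1 :> nat then p else 0%N.
  move=> rP; have [p0|p0] := posnP p; first by move: (p_le _ rP); case: ifP => _; lia.
  have q0 : q = 0%N by lia.
  have mid0 (j : 'I_n) : (n1 <= j < n2)%N -> j != n1 :> nat -> m (x_ j) = 0%N.
    move=> jP jn; have [i i1] : exists i : 'I_n, i = n1 :> nat.
      by apply: ord_ex; ord_bounds; lia.
    apply: (@sing_mid_x0_last _ charF0 _ _ _ le_n _ S i j) => //; try lia.
    by move: (q_le j jP); lia.
  case: eqP => [r1|/eqP]; last exact: mid0.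
  by rewrite /p (@sum_only _ _ _ r) // => i iP ir; apply: mid0 => //; lia.
have ymid (r : 'I_n) : (n1 <= r < n2)%N -> m (y_ r) = if r.+1 == n2 :> nat then q else 0%N.
  move=> rP; have [p0|p0] := posnP q; first by move: (q_le _ rP); case: ifP => _; lia.
  have q0 : p = 0%N by lia.
  have mid0 (j : 'I_n) : (n1 <= j < n2)%N -> j.+1 != n2 :> nat -> m (y_ j) = 0%N.
    move=> jP jn; have [i i1] : exists i : 'I_n, i.+1 = n2 :> nat.
      by have [|i i1] := @ord_ex n2.-1; [lia | exists i; lia].
    apply: (@sing_mid_y0 _ charF0 _ _ _ _ S j i) => //; try lia.
    by move: (p_le j jP); lia.
  case: eqP => [r1|/eqP]; last exact: mid0.
  by rewrite /q (@sum_only _ _ _ r) // => i iP ir; apply: mid0 => //; lia.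
have El1 : (m (x_ a) = neg_part l1) * (p = pos_part l1).
  by rewrite /neg_part /pos_part; case: (l1) pl1 => l; split; lia.
have El2 : (K = neg_part l2) * (q = pos_part l2).
  by rewrite /neg_part /pos_part; case: (l2) ql2 => l; split; lia.
have n12F : (n1 == n2) = false by lia.
apply: mnm_xyP => i; rewrite ?hw_mnm_x ?hw_mnm_y n12F addn0 -?El1 -?El2.
  case: eqP => [/eqa-> //|i1]; have [il|li] := ltnP i n1.
    by rewrite xlow; [case: eqP|]; lia.
  have [im|mi] := ltnP i n2; first by rewrite xmid ?li.
  by rewrite xhigh //; case: eqP; lia.
have [im|mi] := ltnP i n2; last by rewrite yhigh' //; case: eqP => //; case: eqP; lia.
have -> : (i == n2 :> nat) = false by lia.
have [il|li] := ltnP i n1; last by rewrite ymid ?li.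
by rewrite ylow //; case: eqP; lia.
Qed.

(** Only the exponents of x_{n1}, y_{n1-1}, y_{n1+1} and x_{n1+2} can be positive,
    and E_ij f = 0 for i <= n1 < j excludes y_{n1-1} with y_{n1+1} and x_{n1} with
    x_{n1+2}. *)
Lemma lowest_unique_eq (m : 'X_{1..n + n}) : n1 = n2 ->
  xdeg n1 m = l1 -> ydeg n2 m = l2 -> lowest n1 n2 m -> psi m != 0 ->
  m = hw_mnm n n1 n2 l1 l2.
Proof.
move=> n12E ml1 ml2 [ma mb] pm.
have [a an1] := a_ex; have {}ma := ma a an1.
have eqa (a' : 'I_n) : a'.+1 = n1 -> a' = a by move=> ?; apply: val_inj => /=; lia.
have xlow (i : 'I_n) : (i < a)%N -> m (x_ i) = 0%N.
  by move=> ?; apply: (sing_x_low0 charF0 S an1).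
have yhigh (s : 'I_n) : (n2 < s)%N -> m (y_ s) = 0%N.
  move=> sP; have [b bn2] : exists b : 'I_n, b = n2 :> nat by apply: ord_ex; ord_bounds; lia.
  by apply: (sing_y_high0 charF0 le_n S bn2) => //; [lia | apply: mb].
have ylow (i : 'I_n) : (i.+2 < n1)%N -> m (y_ i) = 0%N.
  move=> iP; have [a' a'a] : exists a' : 'I_n, a'.+1 = a.
    by have [|a' a'1] := @ord_ex a.-1; [ord_bounds; lia | exists a'; lia].
  by apply: (sing_y_low1 charF0 S an1 a'a) => //; lia.
have xhigh (s : 'I_n) : (n2.+1 < s)%N -> m (x_ s) = 0%N.
  move=> sP; have [b bn2] : exists b : 'I_n, b = n2 :> nat by apply: ord_ex; ord_bounds; lia.
  have [b' b'b] : exists b' : 'I_n, b' = b.+1 :> nat by apply: ord_ex; ord_bounds; lia.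
  by apply: (sing_x_high1 charF0 le_n S bn2 b'b) => //; [lia | apply: mb].
move: ml1 ml2; rewrite (xdeg_nat _ n12) (ydeg_nat _ n12).
have mid0 (f : 'I_n -> nat) : (\sum_(r < n | n1 <= r < n2) f r = 0)%N.
  by apply: big1 => r; lia.
rewrite !mid0 add0n addn0.
have -> : (\sum_(i < n | i < n1) m (x_ i) = m (x_ a))%N.
  by apply: sum_only => [|i iP ia]; [lia | apply: xlow; lia].
have yK : exists K, (\sum_(s < n | n2 <= s) m (y_ s) = K)%N /\
    (forall s : 'I_n, (n2 <= s)%N -> m (y_ s) = if s == n2 :> nat then K else 0%N) /\
    ((0 < K)%N -> (n2 < n)%N).
  have [n2n|nn2] := ltnP n2 n; last first.
    by exists 0%N; do !split=> //; [apply: big1 => s sP|move=> s sP]; ord_bounds; lia.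
  have [b bn2] := ord_ex n2n; exists (m (y_ b)); do !split=> //.
    by apply: sum_only => [|s sP sb]; [lia | apply: yhigh; lia].
  move=> s sP; case: eqP => [sn|]; last by move=> ?; apply: yhigh; lia.
  by congr (m (y_ _)); apply: val_inj => /=; lia.
have xp : exists p, (\sum_(s < n | n2 <= s) m (x_ s) = p)%N /\
    (forall s : 'I_n, (n2 <= s)%N -> m (x_ s) = if s == n2.+1 :> nat then p else 0%N) /\
    ((0 < p)%N -> (n2.+1 < n)%N).
  have [n2n|nn2] := ltnP n2.+1 n; last first.
    exists 0%N; do !split=> //; [apply: big1 => s sP|move=> s sP; case: ifP => _];
      apply: mb; ord_bounds; lia.
  have [b bn2] := ord_ex n2n; exists (m (x_ b)).
  have s0 (s : 'I_n) : (n2 <= s)%N -> s != n2.+1 :> nat -> m (x_ s) = 0%N.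
    move=> sP sn; have [/eqP sE|sE] := boolP (s == n2 :> nat); first exact: mb.
    by apply: xhigh; lia.
  do !split=> //; first by apply: sum_only => [|s sP sb]; [lia | apply: s0; lia].
  move=> s sP; case: eqP => [sn|]; last by move=> ?; apply: s0; lia.
  by congr (m (x_ _)); apply: val_inj => /=; lia.
have yq : exists q, (\sum_(i < n | i < n1) m (y_ i) = q)%N /\
    (forall i : 'I_n, (i < n1)%N -> m (y_ i) = if i.+2 == n1 :> nat then q else 0%N) /\
    ((0 < q)%N -> (1 < n1)%N).
  have s0 (i : 'I_n) : (i < n1)%N -> i.+2 != n1 :> nat -> m (y_ i) = 0%N.
    move=> iP si; have [/eqP sE|sE] := boolP (i.+1 == n1); first by rewrite (eqa i).
    by apply: ylow; lia.
  have [n1_1|n1_1] := leqP n1 1.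
    by exists 0%N; do !split=> //;
      [apply: big1 => s sP|move=> s sP; case: ifP => _]; apply: s0; lia.
  have [|b bn2] := @ord_ex n1.-2; first lia.
  exists (m (y_ b)); do !split=> //.
    by apply: sum_only => [|s sP sb]; [lia | apply: s0; lia].
  move=> s sP; case: eqP => [sn|]; last by move=> ?; apply: s0; lia.
  by congr (m (y_ _)); apply: val_inj => /=; lia.
case: yK xp yq => K [-> [yK K_n]] [p [-> [xp p_n]]] [q [-> [yq q_n]]] pl1 ql2.
have kp : (0 < p)%N -> m (x_ a) = 0%N.
  move=> p0; have [b bn2] := @ord_ex n2 (ltnW (p_n p0)).
  have [b' b'n2] := ord_ex (p_n p0).
  apply: (@sing_x_low_high _ charF0 _ _ _ le_n _ S b b' a) => //; try lia.
    exact: mb.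
  by rewrite xp ?b'n2 ?eqxx //; lia.
have qK : (0 < q)%N -> K = 0%N.
  move=> q0; have [//|K0] := posnP K; have [s sn2] := ord_ex (K_n K0).
  have [|b bn1] := @ord_ex n1.-2; first lia.
  have : m (y_ s) = 0%N; last by rewrite yK ?sn2 ?eqxx //; lia.
  apply: (@sing_y_low_high _ charF0 _ _ _ _ S a b s m n12 an1) => //; try lia.
  by rewrite yq; [case: eqP|]; lia.
have El1 : (m (x_ a) = neg_part l1) * (p = pos_part l1).
  by rewrite /neg_part /pos_part; case: (l1) pl1 => l; split; lia.
have El2 : (K = neg_part l2) * (q = pos_part l2).
  by rewrite /neg_part /pos_part; case: (l2) ql2 => l; split; lia.
have n12T : (n1 == n2) = true by lia.
apply: mnm_xyP => i; rewrite ?hw_mnm_x ?hw_mnm_y n12T addn1 -?El1 -?El2.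
  case: eqP => [/eqa-> //|i1]; have [il|li] := ltnP i n1.
    by rewrite xlow; [case: eqP|]; lia.
  by rewrite xp -?n12E //; lia.
have [im|mi] := ltnP i n1; last first.
  by rewrite yK; [case: eqP => // _; case: eqP|]; lia.
rewrite yq //; have -> : (i == n2 :> nat) = false by lia.
by rewrite -n12E.
Qed.

Lemma lowest_unique (m : 'X_{1..n + n}) :
  xdeg n1 m = l1 -> ydeg n2 m = l2 -> lowest n1 n2 m -> psi m != 0 ->
  m = hw_mnm n n1 n2 l1 l2.
Proof.
have [n12'|n12'] : (n1 < n2)%N \/ n1 = n2 by lia.
- exact: lowest_unique_lt.
- exact: lowest_unique_eq.
Qed.

End Uniqueness.

Section SingularVectors.
Variables (F : fieldType) (n n1 n2 : nat).
Hypothesis le_n : (n1 <= n2 <= n)%N.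
Local Notation V := {mpoly F[n + n]}.
Implicit Types (f : V) (i j : 'I_n).

Definition killed_by_raising f : Prop :=
  forall i j, (i < j)%N -> Eop n1 n2 i j f = 0.

Lemma killed_singular_coefs f : killed_by_raising f -> Dop n1 n2 f = 0 ->
  singular_coefs n1 n2 (dcoef f).
Proof.
move=> sf Df.
pose simp := (@dcoefD F n, @dcoefN F n, @dcoefZ F n, @dcoef_der F n, @dcoef_mulX F n).
have E i j m : (i < j)%N -> dcoef (Eop n1 n2 i j f) m = 0.
  by move=> ij; rewrite sf // dcoef0.
split.
- move=> i j ij jP m; have /eqP := E i j m ij; rewrite /Eop /Ex /Ey.
  have [j1 [i1 [j2 i2]]] : (j < n1)%N /\ (i < n1)%N /\ (j < n2)%N /\ (i < n2)%N by lia.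
  rewrite i1 j1 j2 i2.
  have -> : (i == j) = false by rewrite -val_eqE /=; lia.
  by rewrite scale0r subr0 -opprD dcoefN oppr_eq0 !simp => /eqP.
- move=> i j iP jP m; have ij : (i < j)%N by lia.
  have /eqP := E i j m ij; rewrite /Eop /Ex /Ey.
  have [i1 [j1 [j2 i2]]] :
    (i < n1)%N = true /\ (j < n1)%N = false
    /\ (j < n2)%N = true /\ (i < n2)%N = true by lia.
  rewrite i1 j1 j2 i2.
  by rewrite !simp subr_eq0 => /eqP.
- move=> i j iP jP m; have ij : (i < j)%N by lia.
  have /eqP := E i j m ij; rewrite /Eop /Ex /Ey.
  have [i1 [j1 [j2 i2]]] :
    (i < n1)%N = true /\ (j < n1)%N = false
    /\ (j < n2)%N = false /\ (i < n2)%N = true by lia.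
  rewrite i1 j1 j2 i2.
  by rewrite !simp subr_eq0 => /eqP ->; rewrite -!addmA [in LHS](addmC U_(y_ j)%MM).
- move=> i j iP ij jP m.
  have /eqP := E i j m ij; rewrite /Eop /Ex /Ey.
  have [i1 [j1 [j2 i2]]] :
    (i < n1)%N = false /\ (j < n1)%N = false
    /\ (j < n2)%N = true /\ (i < n2)%N = true by lia.
  rewrite i1 j1 j2 i2.
  by rewrite !simp subr_eq0 => /eqP.
- move=> i j iP jP m; have ij : (i < j)%N by lia.
  have /eqP := E i j m ij; rewrite /Eop /Ex /Ey.
  have [i1 [j1 [j2 i2]]] :
    (i < n1)%N = false /\ (j < n1)%N = false
    /\ (j < n2)%N = false /\ (i < n2)%N = true by lia.
  rewrite i1 j1 j2 i2.
  by rewrite !simp subr_eq0 => /eqP ->; rewrite -!addmA [in LHS](addmC U_(y_ j)%MM).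
- move=> i j iP ij m; have /eqP := E i j m ij; rewrite /Eop /Ex /Ey.
  have [i1 [j1 [j2 i2]]] :
    (i < n1)%N = false /\ (j < n1)%N = false
    /\ (j < n2)%N = false /\ (i < n2)%N = false by lia.
  rewrite i1 j1 j2 i2.
  have -> : (j == i) = false by rewrite -val_eqE /=; lia.
  by rewrite scale0r subr0 opprK !simp => /eqP.
move=> m; apply/esym/eqP; rewrite -subr_eq0; apply/eqP.
rewrite -[RHS](@dcoef0 F n m) -Df /Dop !simp !dcoef_sum opprD addrA [X in X - _ = _]addrC.
by congr (- _ + _ - _); apply: eq_bigr => i _; rewrite !simp.
Qed.

End SingularVectors.

(** * Submodules and their singular vectors *)

Section Submodules.
Variables (F : fieldType) (charF0 : [pchar F] =i pred0) (n n1 n2 : nat).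
Hypothesis le_n : (n1 <= n2 <= n)%N.
Local Notation V := {mpoly F[n + n]}.
Implicit Types (f g u v w : V) (m : 'X_{1..n + n}) (i j : 'I_n).
Local Notation B := (@Bgr F n n1 n2).
Local Notation H := (@Hgr F n n1 n2).
Local Notation E := (@Eop F n n1 n2).
Local Notation D := (@Dop F n n1 n2).
Let n12 : (n1 <= n2)%N. Proof. by case/andP: le_n. Qed.

Lemma Bgr_subspace l1 l2 : subspace (B l1 l2).
Proof.
split; first by apply/BgrP => m; rewrite mcoeff0 eqxx.
move=> a u v /BgrP Bu /BgrP Bv; apply/BgrP => m.
rewrite mcoeffD mcoeffZ; have [u0|/Bu//] := eqVneq u@_m 0.
by rewrite u0 mulr0 add0r => /Bv.
Qed.

Lemma Hgr_subspace l1 l2 : subspace (H l1 l2).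
Proof.
split; first by split; [apply: subspace0 (Bgr_subspace _ _) | rewrite linear0].
move=> a u v [Bu Du] [Bv Dv]; split; first exact: (Bgr_subspace _ _).2.
by rewrite Dop_linear Du Dv scaler0 addr0.
Qed.

Lemma Hgr_Eop l1 l2 i j f : H l1 l2 f -> H l1 l2 (E i j f).
Proof.
by move=> [Bf Df]; split; [apply: Bgr_Eop | rewrite Dop_Eop // Df linear0].
Qed.

Lemma Hgr_act l1 l2 (A : 'M[F]_n) f : H l1 l2 f -> H l1 l2 (act n1 n2 A f).
Proof.
move=> Hf; rewrite actE; apply: subspace_sum => [|i _]; first exact: Hgr_subspace.
apply: subspace_sum => [|j _]; first exact: Hgr_subspace.
by apply: subspaceZ; [apply: Hgr_subspace | apply: Hgr_Eop].
Qed.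

(** The identity matrix acts on B by a scalar, so that sl(n)-submodules are also
    stable under the E_ii. *)
Lemma sl_submodule_Eop (W : V -> Prop) l1 l2 i j f :
  sl_submodule (@act F n n1 n2) W -> B l1 l2 f -> W f -> W (E i j f).
Proof.
move=> [subW actW] Bf Wf; have [->|ij] := eqVneq i j; last first.
  rewrite -act_delta; apply: actW => //; rewrite /mxtrace big1 // => k _.
  by rewrite mxE; case: eqP => // ->; rewrite (negbTE ij).
pose a : F := n%:R^-1.
have -> : E j j f = act n1 n2 (delta_mx j j - a%:M) f + a *: \sum_k E k k f.
  by rewrite act_trace0 subrK.
apply: subspaceD => //; last first.
  by apply: subspaceZ => //; rewrite (sum_Eii le_n Bf); apply: subspaceZ.
apply: actW => //; rewrite linearB /= mxtrace_scalar -mulr_natr mulVf.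
  rewrite /mxtrace (bigD1 j) //= mxE eqxx big1 ?addr0 ?subrr // => k /negbTE kj.
  by rewrite mxE kj.
have /pcharf0P -> := charF0; have := ltn_ord j; lia.
Qed.

(** The height of a weight w is the sum of the (n - i) w_i: adding the root of
    E_ij with i < j increases it by j - i. *)
Definition ht_vec : 'I_(n + n) -> int :=
  xy_vec (fun i => (n - i)%N%:Z * sgn_lt n1 i) (fun i => (n - i)%N%:Z * sgn_lt n2 i).

Lemma ht_le_deg m : mgrade ht_vec m <= n%:Z * mgrade (fun=> 1) m.
Proof.
rewrite /mgrade mulr_sumr; apply: ler_sum => u _; rewrite mul1r.
apply: ler_wpM2r => //; rewrite /ht_vec /xy_vec /sgn_lt.
by case: split => i; case: ifP => _; lia.
Qed.

Lemma graded_le Q c t t' f : (forall s, Q (s - t)  -> Q (s - t')) ->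
  graded Q c t f -> graded Q c t' f.
Proof. by move=> QQ gf m /gf /QQ. Qed.

Lemma graded_deg_Eop t i j f : (i < j)%N ->
  graded (fun s => s <= 0) (fun=> 1) t f -> graded (fun s => s <= 0) (fun=> 1) t (E i j f).
Proof.
move=> ij gf; rewrite EopE; apply: gradedD; last apply: gradedN.
  have := graded_PxQx (n1 := n1) (i := i) (j := j) gf; apply: graded_le => s.
  by rewrite /sgn_lt; case: (ltnP i n1) => i1; case: (ltnP j n1) => j1; lia.
have := graded_PyQy (n2 := n2) (i := j) (j := i) gf; apply: graded_le => s.
by rewrite /sgn_lt; case: (ltnP i n2) => i1; case: (ltnP j n2) => j1; lia.
Qed.

Lemma graded_ht_Eop t i j f : (i < j)%N ->
  graded (fun s => 0 <= s) ht_vec t f -> graded (fun s => 0 <= s) ht_vec (t + 1) (E i j f).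
Proof.
move=> ij gf; have /= := @graded_Eop F n n1 n2 _ _ _ ((n - i)%N%:Z - (n - j)%N%:Z) i j _ gf.
rewrite /ht_vec !xy_vec_x !xy_vec_y.
rewrite !(mulrCA (sgn_lt _ _)) !sgn_lt2 !mulr1 => /(_ erefl erefl); apply: graded_le => s.
by have := ltn_ord j; lia.
Qed.

(** Apply raising operators as long as possible: the least height of the
    monomials increases, and it is at most n times the initial degree. *)
Lemma singular_exists (W : V -> Prop) t f :
  (forall i j g, (i < j)%N -> W g -> W (E i j g)) -> W f -> f != 0 ->
  graded (fun s => 0 <= s) ht_vec t f ->
  exists v, [/\ W v, v != 0, killed_by_raising n1 n2 v
    & graded (fun s => 0 <= s) ht_vec t v].
Proof.
move=> WE Wf f0 gf.
have [d gd] : exists d : int, graded (fun s => s <= 0) (fun=> 1) d f.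
  pose deg m := mgrade (fun=> 1) m : int.
  pose X := (\max_(m <- msupp f) `|deg m|)%N.
  exists X%:Z => m; rewrite -mcoeff_msupp => fm.
  have : (`|deg m| <= X)%N by apply: (@leq_bigmax_seq _ _ xpredT (fun m => `|deg m|%N)).
  by rewrite -/(deg m); lia.
have [N] : exists N : nat, n%:Z * d - t < N%:Z by exists (absz (n%:Z * d - t)%R).+1; lia.
elim: N t f Wf f0 gf gd => [|N IH] t f Wf f0 gf gd ltN.
  have [m fm] : exists m, f@_m != 0.
    apply: NNPP => f_0; case/eqP: f0; apply/mpolyP => m; rewrite mcoeff0.
    by apply/eqP/negPn/negP => fm; apply: f_0; exists m.
  have := ht_le_deg m; have := gf m fm; have := gd m fm => /= le_d le_t.
  have : n%:Z * mgrade (fun=> 1) m <= n%:Z * d by apply: ler_wpM2l => //; lia.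
  by move=> ? ?; exfalso; lia.
have [kf|nkf] := classic (killed_by_raising n1 n2 f); first by exists f.
have [i [j [ij Ef]]] : exists i j, (i < j)%N /\ E i j f != 0.
  apply: NNPP => nE; apply: nkf => i j ij; apply/eqP/negPn/negP => Ef.
  by apply: nE; exists i, j.
have [|||||v [Wv v0 kv gv]] := IH (t + 1) (E i j f).
- exact: WE.
- exact: Ef.
- exact: graded_ht_Eop.
- exact: graded_deg_Eop.
- lia.
by exists v; split=> //; apply: graded_le gv => s; lia.
Qed.

Definition weight_vec f := forall m m' i, f@_m != 0 -> f@_m' != 0 ->
  wt n1 n2 i m = wt n1 n2 i m'.

(** If two monomials of f have different i-th weights, subtracting from E_ii f
    the multiple of f by one of them removes a monomial and creates none.  So a
    vector with [P] and of minimal support is a weight vector. *)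
Lemma min_weight (P : V -> Prop) :
  (forall f i m m', P f -> f@_m != 0 -> f@_m' != 0 ->
     wt n1 n2 i m != wt n1 n2 i m' ->
     P (E i i f - (wt n1 n2 i m)%:~R *: f) \/ P (E i i f - (wt n1 n2 i m')%:~R *: f)) ->
  (exists f, P f) -> exists2 f, P f & weight_vec f.
Proof.
move=> PE [f]; move: {2}(size _) (leqnn (size (msupp f))) => N.
elim: N f => [|N IH] f.
  rewrite leqn0 size_eq0 msupp_eq0 => /eqP-> P0; exists 0 => // m m' i.
  by rewrite mcoeff0 eqxx.
move=> szf Pf; have [wf|nwf] := classic (weight_vec f); first by exists f.
have step m i : f@_m != 0 -> (size (msupp (E i i f - (wt n1 n2 i m)%:~R *: f)%R) <= N)%N.
  move=> fm; rewrite -ltnS; apply: leq_trans szf.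
  rewrite (perm_size (perm_to_rem _ : perm_eq (msupp f) (m :: rem m (msupp f)))) /=.
    rewrite ltnS; apply: uniq_leq_size => [|p]; first exact: msupp_uniq.
    rewrite mcoeff_msupp mcoeffB coef_Eii mcoeffZ -mulrBl mulf_eq0 negb_or => /andP[wp fp].
    rewrite mem_rem_uniq ?msupp_uniq // inE mcoeff_msupp fp andbT.
    by apply: contraNneq wp => ->; rewrite subrr.
  by rewrite mcoeff_msupp.
have [m [m' [i [fm [fm' wmm]]]]] : exists m m' i,
    f@_m != 0 /\ f@_m' != 0 /\ wt n1 n2 i m != wt n1 n2 i m'.
  apply: NNPP => nE; apply: nwf => m m' i fm fm'; apply/eqP/negPn/negP => wmm.
  by apply: nE; exists m, m', i.
by case: (PE f i m m' Pf fm fm' wmm) => /IH; apply; apply: step.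
Qed.

Lemma weight_vec_Eii f i m : weight_vec f -> f@_m != 0 ->
  E i i f = (wt n1 n2 i m)%:~R *: f.
Proof.
move=> wf fm; apply/mpolyP => p; rewrite coef_Eii mcoeffZ.
have [->|fp] := eqVneq f@_p 0; first by rewrite !mulr0.
by rewrite (wf p m i fp fm).
Qed.

End Submodules.

Section Bounded.
Variables (n n1 n2 : nat) (le_n : (n1 <= n2 <= n)%N).
Implicit Types (m : 'X_{1..n + n}).

(** The weights bound the exponents of all variables but the middle ones, whose
    sums are then bounded by means of the two degrees.  So the weight spaces of
    B are finite-dimensional. *)
Lemma mdeg_bound m : (mdeg m <= absz (xdeg n1 m) + absz (ydeg n2 m)
   + 2 * \sum_(i < n) absz (wt n1 n2 i m))%N.
Proof.
have n12 : (n1 <= n2)%N by lia.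
rewrite (xdeg_nat _ n12) (ydeg_nat _ n12) mdegE big_split_ord /=.
have split3 (f : 'I_n -> nat) : (\sum_(i < n) f i = \sum_(i < n | (i < n1)%N) f i
    + \sum_(i < n | (n1 <= i < n2)%N) f i + \sum_(i < n | (n2 <= i)%N) f i)%N.
  rewrite (bigID (fun i : 'I_n => (i < n1)%N)) /= -addnA; congr addn.
  rewrite (bigID (fun i : 'I_n => (i < n2)%N)) /=; congr addn; apply: eq_bigl => i; lia.
rewrite !split3.
have low : (\sum_(i < n | (i < n1)%N) m (x_ i) + \sum_(i < n | (i < n1)%N) m (y_ i)
    <= \sum_(i < n | (i < n1)%N) absz (wt n1 n2 i m))%N.
  rewrite -big_split /=; apply: leq_sum => i iP; rewrite /wt /wx /wy iP.
  by have -> : (i < n2)%N = true by [lia]; lia.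
have high : (\sum_(i < n | (n2 <= i)%N) m (x_ i) + \sum_(i < n | (n2 <= i)%N) m (y_ i)
    <= \sum_(i < n | (n2 <= i)%N) absz (wt n1 n2 i m))%N.
  rewrite -big_split /=; apply: leq_sum => i iP; rewrite /wt /wx /wy.
  have -> : (i < n2)%N = false by lia.
  by have -> : (i < n1)%N = false by [lia]; lia.
move: low high.
do ![move: (\sum_(i < n | _) _)%N => ?]; lia.
Qed.

End Bounded.

Section Separation.
Variables (F : fieldType) (charF0 : [pchar F] =i pred0) (n n1 n2 : nat).
Local Notation V := {mpoly F[n + n]}.
Local Notation bil := (@cform F n n1 n2).

(** The finite-dimensional fact that a vector outside a subspace is separated
    from it by a linear form, proved by eliminating the monomials of [M] one by
    one. *)
Lemma separation (W : V -> Prop) (M : seq 'X_{1..n + n}) (u : V) :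
  subspace W -> {subset msupp u <= M} -> ~ W u ->
  exists b : V, [/\ {subset msupp b <= M}, bil b u != 0
    & forall w, W w -> {subset msupp w <= M} -> bil b w = 0].
Proof.
move=> subW; have subM (p : V) (L : seq _) :
    {subset msupp p <= L} <-> (forall m, p@_m != 0 -> m \in L).
  by split=> pL m; [rewrite -mcoeff_msupp | rewrite mcoeff_msupp]; apply: pL.
elim: M u => [|m M IH] u /subM uM nWu.
  case: nWu; suff -> : u = 0 by apply: subspace0.
  apply/mpolyP => m; rewrite mcoeff0; apply/eqP/negPn/negP => /uM.
  by rewrite in_nil.
have [[w0 [Ww0 /subM w0M w0m]]|none] := classic
   (exists w, [/\ W w, {subset msupp w <= m :: M} & w@_m != 0]).
- (* w0 serves to clear the coefficient at m *)
  pose el (w : V) := w - (w@_m / w0@_m) *: w0.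
  have elM w : {subset msupp w <= m :: M} -> {subset msupp (el w) <= M}.
    move=> /subM wM; apply/subM => p; rewrite mcoeffB mcoeffZ.
    have [->|pm] := eqVneq p m; first by rewrite divfK // subrr eqxx.
    have [->|/wM] := eqVneq w@_p 0; last by rewrite inE (negbTE pm).
    rewrite sub0r oppr_eq0 mulf_eq0 negb_or => /andP[_ /w0M].
    by rewrite inE (negbTE pm).
  have [||b [/subM bM bu bW]] := IH (el u).
  + by apply: elM; apply/subM.
  + move=> Wel; apply: nWu; rewrite -[u](subrK ((u@_m / w0@_m) *: w0)).
    by apply: subspaceD => //; apply: subspaceZ.
  have nm : mnm_norm F n1 n2 m * w0@_m != 0 by rewrite mulf_neq0 // mnm_norm_neq0.
  (* the coefficient at m for which the form of b also vanishes on w0 *)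
  pose c := - (bil b w0 / (mnm_norm F n1 n2 m * w0@_m)).
  exists (c *: 'X_[m] + b).
  have b'w0 : bil (c *: 'X_[m] + b) w0 = 0.
    by rewrite cform_linear_l cformX /c mulNr divfK // addNr.
  have bil_el w : bil (c *: 'X_[m] + b) w = bil b (el w).
    rewrite -[w in LHS](subrK ((w@_m / w0@_m) *: w0)) [X in bil _ X]addrC cform_linear_r.
    rewrite b'w0 mulr0 add0r.
    rewrite -/(el w) cform_linear_l cformX.
    by rewrite /el mcoeffB mcoeffZ divfK // subrr !mulr0 add0r.
  split.
  + apply/subM => p; rewrite mcoeffD mcoeffZ mcoeffX inE.
    have [->//|pm] := eqVneq p m; rewrite mulr0 add0r.
    exact: bM.
  + by rewrite bil_el.
  + move=> w Ww wM; rewrite bil_el; apply: bW; last exact: elM.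
    by apply: subspaceB => //; apply: subspaceZ.
have Wm0 w : W w -> {subset msupp w <= m :: M} -> w@_m = 0.
  by move=> Ww wM; apply/eqP/negPn/negP => wm; apply: none; exists w.
have Wred w : W w -> {subset msupp w <= m :: M} -> {subset msupp w <= M}.
  move=> Ww wM; apply/subM => p wp; have := wM p; rewrite mcoeff_msupp => /(_ wp).
  by rewrite inE => /orP[/eqP pm|//]; move: wp; rewrite pm Wm0 ?eqxx.
have [um|um] := eqVneq u@_m 0.
  have [||b [/subM bM bu bW]] := IH u => //.
    apply/subM => p up; have := uM p up; rewrite inE => /orP[/eqP pm|//].
    by move: up; rewrite pm um eqxx.
  exists b; split=> //; first by apply/subM => p /bM; rewrite inE orbC => ->.
  by move=> w Ww wM; apply: bW => //; apply: Wred.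
exists 'X_[m]; split.
- by move=> p; rewrite msuppX !inE => ->.
- by rewrite cformX mulf_neq0 // mnm_norm_neq0.
- by move=> w Ww wM; rewrite cformX Wm0 // mulr0.
Qed.
End Separation.

Section SingularLine.
Variables (F : fieldType) (charF0 : [pchar F] =i pred0) (n n1 n2 : nat).
Hypotheses (n1_gt0 : (0 < n1)%N) (le_n : (n1 <= n2 <= n)%N).
Variables (l1 l2 : int).
Hypothesis l_le : l1 + l2 <= n1%:Z - n2%:Z + 1 - (n1 == n2)%:Z.
Local Notation V := {mpoly F[n + n]}.
Implicit Types (f g u v w : V) (m : 'X_{1..n + n}) (i j : 'I_n).
Local Notation B := (@Bgr F n n1 n2 l1 l2).
Local Notation H := (@Hgr F n n1 n2 l1 l2).
Local Notation E := (@Eop F n n1 n2).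
Local Notation killed := (@killed_by_raising F n n1 n2).
Local Notation bil := (@cform F n n1 n2).
Local Notation m0 := (hw_mnm n n1 n2 l1 l2).
Let n12 : (n1 <= n2)%N. Proof. by case/andP: le_n. Qed.

Lemma dcoef_eq0 f m : (dcoef f m == 0) = (f@_m == 0).
Proof.
rewrite /dcoef mulf_eq0; have /pcharf0P -> := charF0.
suff /lt0n_neq0/negbTE-> : (0 < mfac m)%N by [].
by apply: prodn_gt0 => u; exact: fact_gt0.
Qed.

(** By [lowest_unique] the monomials on which [lowest_vanish] tests f reduce to
    [m0]. *)
Lemma singular_eq0 f : H f -> killed f -> f@_m0 = 0 -> f = 0.
Proof.
move=> [/BgrP Bf Df] kf fm0.
have S := killed_singular_coefs le_n kf Df.
apply/mpolyP => m; rewrite mcoeff0; apply/eqP; rewrite -dcoef_eq0; apply/eqP.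
move: m; apply: (lowest_vanish charF0 n1_gt0 le_n S) => m lm.
apply/eqP/negPn/negP => fm.
have fm' : f@_m != 0 by rewrite -dcoef_eq0.
have [mx my] := Bf m fm'.
have mE := lowest_unique charF0 n1_gt0 le_n S l_le mx my lm fm.
by move: fm'; rewrite mE fm0 eqxx.
Qed.

Lemma killed_linear a f g : killed f -> killed g -> killed (a *: f + g).
Proof. by move=> kf kg i j ij; rewrite Eop_linear kf // kg // scaler0 addr0. Qed.

Lemma singular_unique f g : H f -> killed f -> f != 0 -> H g -> killed g ->
  exists c, g = c *: f.
Proof.
move=> Hf kf f0 Hg kg; have fm : f@_m0 != 0.
  by apply: contraNneq f0 => fm; apply/eqP/singular_eq0.
exists (g@_m0 / f@_m0); apply/subr0_eq; rewrite addrC -scaleNr.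
apply: singular_eq0; last by rewrite mcoeffD mcoeffZ mulNr divfK // addNr.
- exact: (Hgr_subspace _ _ _ _ _ _).2.
- exact: killed_linear.
Qed.

(** The defect E_ii v - w_i v is again singular, and its coefficient at [m0] is
    0. *)
Lemma singular_weight v : H v -> killed v -> forall i,
  E i i v = (wt n1 n2 i m0)%:~R *: v.
Proof.
move=> Hv kv i; apply/subr0_eq; rewrite addrC -scaleNr; apply: singular_eq0.
- by apply: (Hgr_subspace _ _ _ _ _ _).2 => //; apply: Hgr_Eop.
- apply: killed_linear => // j k jk.
  rewrite Eop_bracket (kv j k jk) linear0 add0r.
  case: eqP => [ki|_]; case: eqP => [ij|_]; rewrite ?scale0r ?subr0 ?scale1r ?sub0r //.
  + by move: jk; rewrite ki ij ltnn.
  + by rewrite -ki kv.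
  + by rewrite ij kv ?oppr0.
- by rewrite mcoeffD mcoeffZ mulNr coef_Eii addNr.
Qed.

End SingularLine.

(** * Irreducibility *)

Section Ladder.
Variables (F : fieldType) (n n1 n2 : nat).
Hypotheses (le_n : (n1 <= n2 <= n)%N).
Variables (l1 l2 : int).
Local Notation G := (fun j : nat => @Bgr F n n1 n2 (l1 - j%:Z) (l2 - j%:Z)).
Let n12 : (n1 <= n2)%N. Proof. by case/andP: le_n. Qed.

Lemma ladder_sub j : subspace (G j). Proof. exact: Bgr_subspace. Qed.

Lemma ladder_D j f : G j f -> G j.+1 (Dop n1 n2 f).
Proof.
move/(Bgr_Dop n12) => /=; rewrite -!addrA -!opprD.
by have -> : j%:Z + 1 = j.+1%:Z by lia.
Qed.

Lemma ladder_eta j f : G j.+1 f -> G j (etaop n1 n2 f).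
Proof.
move/(Bgr_etaop n12) => /=.
have -> : l1 - j.+1%:Z + 1 = l1 - j%:Z by lia.
by have -> : l2 - j.+1%:Z + 1 = l2 - j%:Z by lia.
Qed.

Lemma ladder_comm j f : G j.+1 f ->
  Dop n1 n2 (etaop n1 n2 f) = etaop n1 n2 (Dop n1 n2 f)
    + (l1 + l2 + n2%:Z - n1%:Z - j.+1%:Z *+ 2)%:~R *: f.
Proof.
move/(Dop_etaop_Bgr le_n) => ->; congr (_ + _%:~R *: _); lia.
Qed.
End Ladder.

Section NotIsotropic.
Variables (F : fieldType) (charF0 : [pchar F] =i pred0) (n n1 n2 : nat).
Hypotheses (n1_gt0 : (0 < n1)%N) (le_n : (n1 <= n2 <= n)%N).
Variables (l1 l2 : int).
Hypothesis l_le : l1 + l2 <= n1%:Z - n2%:Z + 1 - (n1 == n2)%:Z.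
Local Notation V := {mpoly F[n + n]}.
Implicit Types (f g u v w : V) (m : 'X_{1..n + n}) (i j : 'I_n).
Local Notation B := (@Bgr F n n1 n2 l1 l2).
Local Notation H := (@Hgr F n n1 n2 l1 l2).
Local Notation E := (@Eop F n n1 n2).
Local Notation killed := (@killed_by_raising F n n1 n2).
Local Notation bil := (@cform F n n1 n2).
Local Notation m0 := (hw_mnm n n1 n2 l1 l2).
Local Notation lwt := (wt n1 n2).
Let n12 : (n1 <= n2)%N. Proof. by case/andP: le_n. Qed.
Let c_le1 : l1 + l2 + n2%:Z - n1%:Z <= 1.
Proof. by clear -l_le; move: l_le; case: eqP => _; lia. Qed.

Lemma Bgr_split f : B f -> exists u v, [/\ H u,
  Bgr n1 n2 (l1 - 1) (l2 - 1) v & f = u + etaop n1 n2 v].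
Proof.
move=> Bf; have := @split_kernel F charF0 V (@Dop F n n1 n2) (@etaop F n n1 n2) _ _
  (@ladder_sub F n n1 n2 l1 l2) (@ladder_D F n n1 n2 le_n l1 l2)
  (@ladder_eta F n n1 n2 le_n l1 l2) (@ladder_comm F n n1 n2 le_n l1 l2) c_le1
  (@Dop_nilpotent F n n1 n2 n12) 0 f.
by rewrite !subr0; apply.
Qed.

Lemma Hgr_orthogonal_etaop u v : H u -> bil u (etaop n1 n2 v) = 0.
Proof.
move=> [_ Du]; by rewrite -cform_Dop // Du cformC raddf0.
Qed.

(** Modulo eta B, which is orthogonal to H, every element of B is in H. *)
Lemma Hgr_projection u f : H u -> B f -> exists2 h, H h & forall w, H w -> bil w h = bil w f.
Proof.
move=> Hu Bf; have [h [g [Hh Bg ->]]] := Bgr_split Bf; exists h => // w Hw.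
by rewrite raddfD /= (Hgr_orthogonal_etaop _ Hw) addr0.
Qed.

(** The form is nondegenerate on B, where monomials are orthogonal, and
    B = H + eta B with eta B orthogonal to H. *)
Lemma Hgr_nondegenerate v : H v -> v != 0 -> exists2 z, H z & bil v z != 0.
Proof.
move=> Hv v0; have [m vm] : exists m, v@_m != 0.
  apply: NNPP => v_0; case/eqP: v0; apply/mpolyP => m; rewrite mcoeff0.
  by apply/eqP/negPn/negP => vm; apply: v_0; exists m.
have BX : B 'X_[m].
  apply/BgrP => p; rewrite mcoeffX; case: (m =P p) => [<- _|_]; last by rewrite eqxx.
  by have [/BgrP/(_ m vm)] := Hv.
have [z Hz zE] := Hgr_projection Hv BX; exists z => //.
by rewrite zE // cformC cformX mulf_neq0 // mnm_norm_neq0.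
Qed.

(** A nonzero f of this height would lead to a singular vector, hence to a
    multiple of v, whose height is that of [m0]. *)
Lemma no_height_above_highest f v : H f -> f != 0 -> H v -> v != 0 -> killed v ->
  graded (fun s => 0 <= s) (ht_vec n1 n2) (mgrade (ht_vec n1 n2) m0 + 1) f -> False.
Proof.
move=> Hf f0 Hv v0 kv gf.
have [|w [Hw w0 kw gw]] := singular_exists le_n _ Hf f0 gf.
  by move=> i j g _; apply: Hgr_Eop.
have wm : w@_m0 != 0.
  by apply: contraNneq w0 => wm; apply/eqP/(singular_eq0 charF0 n1_gt0 le_n l_le).
by have := gw m0 wm; rewrite opprD addrA subrr sub0r; lia.
Qed.

Lemma ht_of_weight m m' : (forall i, lwt i m = lwt i m') ->
  mgrade (ht_vec n1 n2) m = mgrade (ht_vec n1 n2) m'.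
Proof.
move=> wE; rewrite !mgrade_xy -!big_split /=; apply: eq_bigr => i _.
rewrite -!mulrA -!mulrDr; congr (_ * _).
by have := wE i; rewrite /wt /wx /wy /sgn_lt; case: ifP => _; case: ifP => _; lia.
Qed.

(** Otherwise v is orthogonal to its multiples; but v pairs nontrivially with
    some weight vector z of H, which then has the weight of v and is therefore
    singular, hence a multiple of v. *)
Lemma hw_not_isotropic v : H v -> v != 0 -> killed v -> bil v v != 0.
Proof.
move=> Hv v0 kv; apply/negP => /eqP vv0.
have vE i : E i i v = (lwt i m0)%:~R *: v by exact: (singular_weight charF0 n1_gt0 le_n l_le).
have [||z [Hz vz] wz] := @min_weight F n n1 n2 (fun z => H z /\ bil v z != 0).
- move=> f i p p' [Hf vf] fp fp' wpp.
  have HE a : H (E i i f - a *: f).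
    rewrite addrC -scaleNr; apply: (Hgr_subspace _ _ _ _ _ _).2 => //; exact: Hgr_Eop.
  have bE a : bil v (E i i f - a *: f) = ((lwt i m0)%:~R - a) * bil v f.
    by rewrite raddfB /= linearZ /= -cform_Eop vE cformZl mulrBl.
  have [wp|wp] := eqVneq (lwt i m0) (lwt i p); [right|left]; split; rewrite // bE mulf_neq0 //.
    by rewrite -rmorphB /=; apply: intr_neq0; rewrite // wp subr_eq0.
  by rewrite -rmorphB /=; apply: intr_neq0; rewrite // subr_eq0.
- by have [z Hz vz] := Hgr_nondegenerate Hv v0; exists z.
have [p [vp zp]] : exists p, v@_p != 0 /\ z@_p != 0.
  apply: NNPP => no; case/eqP: vz; apply: big1_seq => p /andP[_]; rewrite mcoeff_msupp => vp.
  by have [->|zp] := eqVneq z@_p 0; [rewrite mulr0 | case: no; exists p].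
have wtp i : lwt i p = lwt i m0.
  have := congr1 (mcoeff p) (vE i); rewrite coef_Eii mcoeffZ => /eqP.
  rewrite -subr_eq0 -mulrBl mulf_eq0 (negbTE vp) orbF -rmorphB /= => /eqP wi.
  by apply/eqP; rewrite -subr_eq0; apply: contraT => /(intr_neq0 charF0); rewrite wi eqxx.
have kz : killed z.
  move=> i j ij; apply/eqP/negPn/negP => Ez.
  apply: (no_height_above_highest _ Ez Hv v0 kv); first exact: Hgr_Eop.
  apply: graded_ht_Eop => // q zq.
  by rewrite (@ht_of_weight q m0) ?subrr // => k; rewrite (wz q p k zq zp).
have [c zE] := singular_unique charF0 n1_gt0 le_n l_le Hv kv v0 Hz kz.
by move: vz; rewrite zE linearZ /= vv0 mulr0 eqxx.
Qed.

End NotIsotropic.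

Section Irreducible.
Variables (F : fieldType) (charF0 : [pchar F] =i pred0) (n n1 n2 : nat).
Hypotheses (n1_gt0 : (0 < n1)%N) (le_n : (n1 <= n2 <= n)%N).
Variables (l1 l2 : int).
Hypothesis l_le : l1 + l2 <= n1%:Z - n2%:Z + 1 - (n1 == n2)%:Z.
Local Notation V := {mpoly F[n + n]}.
Implicit Types (f g u v w : V) (m : 'X_{1..n + n}) (i j : 'I_n).
Local Notation B := (@Bgr F n n1 n2 l1 l2).
Local Notation H := (@Hgr F n n1 n2 l1 l2).
Local Notation E := (@Eop F n n1 n2).
Local Notation rho := (@act F n n1 n2).
Local Notation killed := (@killed_by_raising F n n1 n2).
Local Notation bil := (@cform F n n1 n2).
Local Notation m0 := (hw_mnm n n1 n2 l1 l2).
Local Notation lwt := (wt n1 n2).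

Lemma Hgr_singular_exists (W : V -> Prop) f :
  (forall i j g, (i < j)%N -> W g -> W (E i j g)) -> W f -> f != 0 ->
  exists v, [/\ W v, v != 0 & killed v].
Proof.
move=> WE Wf f0; pose N := (\max_(m <- msupp f) `|mgrade (ht_vec n1 n2) m|)%N.
have [|v [Wv v0 kv _]] := @singular_exists F n n1 n2 le_n W (- N%:Z) f WE Wf f0; last by exists v.
move=> m; rewrite -mcoeff_msupp => fm.
have : (`|mgrade (ht_vec n1 n2) m| <= N)%N.
  by apply: (@leq_bigmax_seq _ _ xpredT (fun m => `|mgrade (ht_vec n1 n2) m|%N)).
lia.
Qed.

Lemma nonzero_sub_Eii (W : V -> Prop) f i m m' : subspace W ->
  lwt i m != lwt i m' -> W (E i i f - (lwt i m)%:~R *: f) ->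
  W (E i i f - (lwt i m')%:~R *: f) -> W f.
Proof.
move=> subW wmm W1 W2; have := subspaceB subW W2 W1.
rewrite opprB addrC addrA subrK -scalerBl -rmorphB /= => Wcf.
have c0 : (lwt i m - lwt i m')%:~R != 0 :> F by apply: intr_neq0; rewrite // subr_eq0.
by rewrite -[f](scalerK c0); apply: subspaceZ.
Qed.

(** A vector of H outside W, of minimal support, is a weight vector; some b of
    the same weight separates it from W.  Projecting b to H gives a nonzero
    vector orthogonal to the part of W in H, so the orthogonal of that part is
    a nonzero submodule of H and contains v, against [hw_not_isotropic]. *)
Lemma hw_generates (W : V -> Prop) v : sl_submodule rho W ->
  H v -> v != 0 -> killed v -> W v -> forall u, H u -> W u.
Proof.
move=> slW Hv v0 kv Wv u0 Hu0; apply: NNPP => nWu0; have subW := slW.1.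
have HE i a f : H f -> H (E i i f - a *: f).
  move=> Hf; rewrite addrC -scaleNr; apply: (Hgr_subspace _ _ _ _ _ _).2 => //.
  exact: Hgr_Eop.
pose W1 w := W w /\ H w.
have subW1 : subspace W1.
  split; first by split; [apply: subspace0 | apply: subspace0 (Hgr_subspace _ _ _ _ _ _)].
  move=> a f g [Wf Hf] [Wg Hg]; split; first exact: subW.2.
  exact: (Hgr_subspace _ _ _ _ _ _).2.
have W1E i j w : W1 w -> W1 (E i j w).
  move=> [Ww Hw]; split; last exact: Hgr_Eop.
  by have [Bw _] := Hw; apply: (sl_submodule_Eop charF0 le_n i j slW Bw Ww).
have [||u [Hu nWu] wu] := @min_weight F n n1 n2 (fun u => H u /\ ~ W u).
- move=> f i m m' [Hf nWf] fm fm' wmm.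
  have [W1'|] := classic (W (E i i f - (lwt i m)%:~R *: f)).
    right; split; first exact: HE.
    by move=> W2'; apply: nWf; apply: (nonzero_sub_Eii subW wmm).
  by left; split; first exact: HE.
- by exists u0.
have [p up] : exists p, u@_p != 0.
  apply: NNPP => u_0; apply: nWu; suff -> : u = 0 by apply: subspace0.
  by apply/mpolyP => m; rewrite mcoeff0; apply/eqP/negPn/negP => um; apply: u_0; exists m.
(* M lists the finitely many monomials with the degrees and weight of u *)
pose C := (absz l1 + absz l2 + 2 * \sum_(i < n) absz (lwt i p))%N.
pose inM m := [&& xdeg n1 m == l1, ydeg n2 m == l2 & [forall i, lwt i m == lwt i p]].
pose M := [seq m <- map (@bmnm _ _) (@bmnm_enum (n + n) C.+1) | inM m]%SEQ.
have MP m : reflect ([/\ xdeg n1 m = l1, ydeg n2 m = l2 & forall i, lwt i m = lwt i p]) (m \in M).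
  rewrite mem_filter; apply: (iffP andP) => [[/and3P[/eqP mx /eqP my /forallP mw] _]|[mx my mw]].
    by split=> // i; apply/eqP.
  split; first by rewrite /inM mx my !eqxx; apply/forallP => i; apply/eqP.
  have mC : (mdeg m < C.+1)%N.
    rewrite ltnS; apply: (leq_trans (mdeg_bound le_n m)); rewrite mx my /C.
    by rewrite (eq_bigr (fun i => absz (lwt i p))) // => i _; rewrite mw.
  apply/mapP; exists (BMultinom mC) => //.
  by rewrite -has_pred1 has_count bmnm_enumP.
have MB w : W1 w -> weight_vec n1 n2 w -> forall m, m \in M -> w@_m != 0 -> {subset msupp w <= M}.
  move=> [_ [/BgrP Bw _]] ww m /MP[_ _ mw] wm q; rewrite mcoeff_msupp => wq; apply/MP.
  by have [qx qy] := Bw q wq; split=> // i; rewrite (ww q m i wq wm).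
have uM : {subset msupp u <= M}.
  move=> m; rewrite mcoeff_msupp => um; apply/MP; have [/BgrP/(_ m um)[mx my] _] := Hu.
  by split=> // i; apply: wu.
have [|b [bM bu bW]] := @separation F charF0 n n1 n2 W1 M u subW1 uM; first by case.
have wb : weight_vec n1 n2 b.
  move=> m m' i; rewrite -!mcoeff_msupp => /bM/MP[_ _ mw] /bM/MP[_ _ mw'].
  by rewrite mw mw'.
have [q bq] : exists q, b@_q != 0.
  apply: NNPP => b_0; case/eqP: bu; suff -> : b = 0 by rewrite cformC raddf0.
  by apply/mpolyP => m; rewrite mcoeff0; apply/eqP/negPn/negP => um; apply: b_0; exists m.
(* different weight spaces are orthogonal *)
have bW1 w : W1 w -> bil b w = 0.
  move=> W1w; apply: NNPP => /eqP bw.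
  have [||z [W1z bz] wz] := @min_weight F n n1 n2 (fun z => W1 z /\ bil b z != 0).
  - move=> f i m m' [W1f bf] fm fm' wmm.
    have W1a a : W1 (E i i f - a *: f).
      by rewrite addrC -scaleNr; apply: subW1.2 => //; apply: W1E.
    have bE a : bil b (E i i f - a *: f) = ((lwt i q)%:~R - a) * bil b f.
      by rewrite raddfB /= linearZ /= -cform_Eop (weight_vec_Eii i wb bq) cformZl mulrBl.
    have [wp|wp] := eqVneq (lwt i q) (lwt i m); [right|left]; split; rewrite // bE mulf_neq0 //.
      by rewrite -rmorphB /=; apply: intr_neq0; rewrite // wp subr_eq0.
    by rewrite -rmorphB /=; apply: intr_neq0; rewrite // subr_eq0.
  - by exists w.
  have [r [br zr]] : exists r, b@_r != 0 /\ z@_r != 0.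
    apply: NNPP => no; case/eqP: bz; apply: big1_seq => r /andP[_]; rewrite mcoeff_msupp => br.
    by have [->|zr] := eqVneq z@_r 0; [rewrite mulr0 | case: no; exists r].
  case/eqP: bz; apply: bW => //; apply: (MB _ W1z wz _ _ zr).
  by apply: bM; rewrite mcoeff_msupp.
have Bb : B b.
  by apply/BgrP => m; rewrite -mcoeff_msupp => /bM/MP[].
have [h Hh hb] := Hgr_projection charF0 le_n l_le Hu Bb.
have h0 : h != 0.
  by apply: contraNneq bu => h0; rewrite cformC -hb // h0 raddf0.
pose W2 f := H f /\ forall w, W1 w -> bil f w = 0.
have [||v' [[Hv' v'W] v'0 kv']] := @Hgr_singular_exists W2 h _ _ h0.
- move=> i j f _ [Hf fW]; split; first exact: Hgr_Eop.
  by move=> w W1w; rewrite cform_Eop; apply: fW; apply: W1E.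
- by split=> // w W1w; rewrite cformC hb; [rewrite cformC bW1 | case: W1w].
have [c vE] := singular_unique charF0 n1_gt0 le_n l_le Hv' kv' v'0 Hv kv.
have /eqP := hw_not_isotropic charF0 n1_gt0 le_n l_le Hv v0 kv; apply.
by rewrite {1}vE cformZl v'W ?mulr0.
Qed.

Lemma Hgr_submodule : sl_submodule rho H.
Proof. by split; [apply: Hgr_subspace | move=> A _ f; apply: Hgr_act]. Qed.

Lemma submodule_dichotomy (W : V -> Prop) :
  sl_submodule rho W -> (forall v, W v -> H v) ->
  (forall v, W v -> v = 0) \/ (forall v, H v -> W v).
Proof.
move=> slW WH; have [[f [Wf f0]]|no] := classic (exists f, W f /\ f != 0); last first.
  by left=> f Wf; apply/eqP/negPn/negP => f0; apply: no; exists f.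
right; have [|v [Wv v0 kv]] := @Hgr_singular_exists W f _ Wf f0.
  move=> i j g _ Wg; have [Bg _] := WH g Wg.
  exact: (sl_submodule_Eop charF0 le_n i j slW Bg Wg).
by apply: (@hw_generates W v) => //; apply: WH.
Qed.

Lemma Hgr_irreducible : nonzero H -> sl_irreducible rho H.
Proof.
by move=> H0; split; [apply: Hgr_submodule | | apply: submodule_dichotomy].
Qed.

Lemma Hgr_highest_weight : nonzero H -> highest_weight_module rho H.
Proof.
case=> f Hf f0; split; first exact: Hgr_submodule.
have [|v [Hv v0 kv]] := @Hgr_singular_exists H f _ Hf f0.
  by move=> i j g _; apply: Hgr_Eop.
exists v; split=> //; last by move=> W slW Wv; apply: (hw_generates slW Hv v0 kv Wv).
split=> // [|i j ij]; last by rewrite act_delta kv.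
exists (\row_i (lwt i m0)%:~R) => d _; rewrite act_diag scaler_suml.
apply: eq_bigr => i _; rewrite (singular_weight charF0 n1_gt0 le_n l_le Hv kv) mxE.
by rewrite scalerA mulrC.
Qed.

End Irreducible.

(** * The decomposition *)

Lemma img_subspace (F : fieldType) (V : lmodType F) (f : V -> V) (U : V -> Prop) :
  linear f -> subspace U -> subspace (img f U).
Proof.
move=> fl [U0 UP]; split.
  exists 0 => //; have := fl 1 0 0; rewrite !scale1r addr0 => /esym/eqP.
  by rewrite -subr_eq0 addrK => /eqP.
move=> a _ _ [u Uu ->] [v Uv ->]; exists (a *: u + v); first exact: UP.
by rewrite fl.
Qed.

Section EtaPowers.
Variables (F : fieldType) (n n1 n2 : nat) (n12 : (n1 <= n2)%N) (m : nat).
Local Notation rho := (@act F n n1 n2).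
Local Notation etam := (iter m (@etaop F n n1 n2)).

Lemma iter_etaop_act A f : etam (rho A f) = rho A (etam f).
Proof.
elim: m => //= k ->; rewrite !actE linear_sum; apply: eq_bigr => i _.
rewrite linear_sum; apply: eq_bigr => j _.
by rewrite linearZ /= etaop_Eop.
Qed.

(** A submodule of the image is the image of its preimage in U, because the
    powers of eta commute with the action. *)
Lemma img_irreducible (U : {mpoly F[n + n]} -> Prop) :
  (nonzero U -> sl_irreducible rho U) -> nonzero (img etam U) ->
  sl_irreducible rho (img etam U).
Proof.
move=> irrU nzU; have [] : sl_irreducible rho U.
  apply: irrU; case: nzU => _ [u Uu ->] u0; exists u => //.
  by apply: contraNneq u0 => ->; rewrite iter_linear0.
move=> [subU actU] _ minU; split=> //; first split.
- by apply: img_subspace => //; apply: iter_linear.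
- move=> A trA _ [u Uu ->]; exists (rho A u); first exact: actU.
  by rewrite iter_etaop_act.
move=> W [subW actW] WU.
have [||W0|WU'] := minU (fun u => U u /\ W (etam u)).
- split; first split.
  + by split; [apply: subspace0 | rewrite iter_linear0; apply: subspace0].
  + move=> a u v [Uu Wu] [Uv Wv]; split; first exact: subU.2.
    by rewrite iter_linear; apply: subW.2.
  + move=> A trA u [Uu Wu]; split; first exact: actU.
    by rewrite iter_etaop_act; apply: actW.
- by move=> u [].
- left=> w Ww; have [u Uu wE] := WU w Ww.
  by rewrite wE (W0 u) ?iter_linear0 // -wE.
- by right=> _ [u Uu ->]; have [_] := WU' u Uu.
Qed.
End EtaPowers.

Theorem theorem1 (F : fieldType) (charF0 : [pchar F] =i pred0)
    (n n1 n2 : nat) (n_ge2 : (2 <= n)%N)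
    (n1_ge1 : (1 <= n1)%N) (n1_le_n2 : (n1 <= n2)%N) (n2_le_n : (n2 <= n)%N)
    (l1 l2 : int)
    (l_le : l1 + l2 <= n1%:Z - n2%:Z + 1 - (n1 == n2)%:Z) :
  [/\ nonzero (@Hgr F n n1 n2 l1 l2) ->
        sl_irreducible (@act F n n1 n2) (@Hgr F n n1 n2 l1 l2) /\
        highest_weight_module (@act F n n1 n2) (@Hgr F n n1 n2 l1 l2),
      is_direct_sum (@Bgr F n n1 n2 l1 l2)
        (fun m : nat => img (iter m (@etaop F n n1 n2))
                              (@Hgr F n n1 n2 (l1 - m%:Z) (l2 - m%:Z))),
      forall m : nat,
        nonzero (img (iter m (@etaop F n n1 n2))
                       (@Hgr F n n1 n2 (l1 - m%:Z) (l2 - m%:Z))) ->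
        sl_irreducible (@act F n n1 n2)
          (img (iter m (@etaop F n n1 n2))
                 (@Hgr F n n1 n2 (l1 - m%:Z) (l2 - m%:Z)))
    & is_direct_sum2 (@Bgr F n n1 n2 l1 l2) (@Hgr F n n1 n2 l1 l2)
        (img (@etaop F n n1 n2) (@Bgr F n n1 n2 (l1 - 1) (l2 - 1)))].
Proof.
have le_n : (n1 <= n2 <= n)%N by rewrite n1_le_n2.
have c_le1 : l1 + l2 + n2%:Z - n1%:Z <= 1.
  by clear -l_le; move: l_le; case: eqP => _; lia.
pose G j := @Bgr F n n1 n2 (l1 - j%:Z) (l2 - j%:Z).
have subG := @ladder_sub F n n1 n2 l1 l2.
have DG := @ladder_D F n n1 n2 le_n l1 l2.
have eG := @ladder_eta F n n1 n2 le_n l1 l2.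
have comm := @ladder_comm F n n1 n2 le_n l1 l2.
have nilD := @Dop_nilpotent F n n1 n2 n1_le_n2.
split.
- by move=> nzH; split; [apply: Hgr_irreducible | apply: Hgr_highest_weight].
- split.
  + by move=> m; apply: img_subspace; [apply: iter_linear | apply: Hgr_subspace].
  + move=> w; split=> [Bw|[k [u [uP ->]]]].
      have [k Dk] := nilD w.
      have := @decompose F charF0 _ _ _ G _ subG DG eG comm c_le1 k 0 w.
      rewrite /G !subr0 => /(_ Bw Dk) [u [uP wE]].
      exists k, (fun m => iter m (@etaop F n n1 n2) (u m)); split=> // m.
      by exists (u m) => //; apply: uP.
    have subB := subG 0; rewrite !subr0 in subB; apply: subspace_sum => // m _.
    have [h [Bh _] ->] := uP m.
    by have := @iter_raise F _ (@etaop F n n1 n2) G eG m 0 h Bh; rewrite /G !subr0.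
  + move=> k u uP.
    apply: (@independent F charF0 _ _ _ G _ eG comm c_le1 k 0 u) => m.
    by have [h Hh uE] := uP m; exists h.
- move=> m; apply: img_irreducible => //.
  by apply: Hgr_irreducible => //; clear -l_le; lia.
split.
- exact: Hgr_subspace.
- by apply: img_subspace; [apply: etaop_linear | apply: Bgr_subspace].
- move=> w; split=> [Bw|[u [_ [[Bu _] [v Bv ->] ->]]]].
    have [u [v [Hu Bv ->]]] := Bgr_split charF0 le_n l_le Bw.
    by exists u, (etaop n1 n2 v); split=> //; exists v.
  have subB := subG 0; rewrite !subr0 in subB; apply: subspaceD => //.
  by have := eG 0 v; rewrite !subr0; apply.
- move=> w [Bw Dw] [v Bv wE].
  apply: (@kernel_raise0 F charF0 _ _ _ G _ subG DG eG comm c_le1 nilD 0 w v _ _ wE).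
    by rewrite /G !subr0.
  exact: Bv.
Qed.
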